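(* Assume that $S$ is a finite product of copies of the field $k$ and let $A$ be an $A_\infty$-algebra. Then every quasi-isomorphism of right $A_\infty$-modules over $A$ is a homotopy equivalence, hence an invertible morphism in $\underline{\mathrm{Mod}}_\infty\text{-}A$.
   Context: Conventions: $k$ is a field acting centrally on all algebras and bimodules; $S$ is graded concentrated in degree $0$. Graded means $\mathbb{Z}$-graded; a homogeneous morphism of degree $d$ shifts degrees by $d$; tensor products are over $S$ with the usual grading; $(f\otimes g)(x\otimes y)=(-1)^{|g||x|}f(x)\otimes g(y)$. An $A_\infty$-algebra is a graded $S$-$S$-bimodule $A$ with bimodule morphisms $m_n:A^{\otimes n}\to A$ of degree $2-n$ ($n\ge1$) with $\sum_{r+s+t=n,\ s\ge1;\,r,t\ge0}(-1)^{r+st}m_{r+1+t}(id^{\otimes r}\otimes m_s\otimes id^{\otimes t})=0$ for all $n\ge1$. $\mathrm{Mod}_\infty\text{-}A$: a right $A_\infty$-module over $A$ is a graded right $S$-module $M$ with morphisms of right $S$-modules $m_n^M:M\otimes A^{\otimes(n-1)}\to M$ of degree $2-n$ ($n\ge1$) such that for all $n\ge1$: $\sum_{r+s+t=n;\,r,s\ge1,t\ge0}(-1)^{r+st}m^M_{r+1+t}(id^{\otimes r}\otimes m_s\otimes id^{\otimes t})+\sum_{s+t=n;\,s\ge1,t\ge0}(-1)^{st}m^M_{1+t}(m^M_s\otimes id^{\otimes t})=0$, where $id^{\otimes r}$ ($r\ge1$) on the left abbreviates $id_M\otimes id_A^{\otimes(r-1)}$. A morphism $f:M\to N$ is a family of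 morphisms of graded right $S$-modules $f_n:M\otimes A^{\otimes(n-1)}\to N$ of degree $1-n$ with $\sum_{r+s+t=n;\,r,s\ge1,t\ge0}(-1)^{r+st}f_{r+1+t}(id^{\otimes r}\otimes m_s\otimes id^{\otimes t})+\sum_{s+t=n;\,s\ge1,t\ge0}(-1)^{st}f_{1+t}(m_s^M\otimes id^{\otimes t})-\sum_{r+s=n;\,r\ge1,s\ge0}(-1)^{(r+1)s}m^N_{1+s}(f_r\otimes id^{\otimes s})=0$ for all $n\ge1$; composition is $(g\circ f)_n=\sum_{r+s=n;\,r\ge1,s\ge0}(-1)^{(r+1)s}g_{1+s}(f_r\otimes id^{\otimes s})$; the identity is $h_1=id_M$, $h_n=0$ for $n\ge2$. For $n=1$ the conditions say that $(M,m_1^M)$ is a complex of right $S$-modules and $f_1$ is a morphism of complexes; $f$ is a quasi-isomorphism if $f_1$ is. A homotopy from $f$ to $g$ (morphisms $M\to N$) is a family of homogeneous morphisms of right $S$-modules $h_n:M\otimes A^{\otimes(n-1)}\to N$ of degree $-n$ with, for all $n\ge1$, $f_n-g_n=\sum_{r+s=n;\,r\ge1,s\ge0}(-1)^{rs}m^N_{1+s}(h_r\otimes id^{\otimes s})+\sum_{s+t=n;\,s\ge1,t\ge0}(-1)^{st}h_{1+t}(m_s^M\otimes id^{\otimes t})+\sum_{r+s+t=n;\,r,s\ge1,t\ge0}(-1)^{r+st}h_{r+1+t}(id^{\otimes r}\otimes m_s\otimes id^{\otimes t})$. $\underline{\mathrm{Mod}}_\infty\text{-}A$ is the quotient of $\mathrm{Mod}_\infty\text{-}A$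 modulo homotopy, and a homotopy equivalence is a morphism whose class is invertible there. *)

(* Defs.v *)
From HB Require Import structures.
From mathcomp Require Import all_boot all_order all_algebra.
From mathcomp Require Import generic_quotient ring_quotient boolp.
From mathcomp.multinomials Require Import freeg.

Set Implicit Arguments.
Unset Strict Implicit.
Unset Printing Implicit Defensive.

Import GRing.Theory.

Local Open Scope ring_scope.
Local Open Scope quotient_scope.

(* A right S-module is a left module over the converse ring S^c.  A grading is
   internal: [homog i x] says that x lies in the degree-i summand, and the last
   two axioms say that M is the direct sum of these summands. *)
HB.mixin Record isGradedRModule (S : pzRingType) M of GRing.Lmodule S^c M := {
  homog : int -> M -> Prop;
  homog0 : forall i, homog i 0;
  homogD : forall i x y, homog i x -> homog i y -> homog i (x + y);
  homogZ : forall i (s : S^c) x, homog i x -> homog i (s *: x);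
  homog_span : forall x, exists (r : seq int) (c : int -> M),
    (forall i, homog i (c i)) /\ x = \sum_(i <- r) c i;
  homog_free : forall (r : seq int) (c : int -> M),
    uniq r -> (forall i, homog i (c i)) -> \sum_(i <- r) c i = 0 ->
    forall i, i \in r -> c i = 0
}.

#[short(type="gradedRModType")]
HB.structure Definition GradedRModule (S : pzRingType) :=
  {M of GRing.Lmodule S^c M & isGradedRModule S M}.

(* The k-algebra structure of S is its structure morphism eta : k -> S; this
   allows S = 0, the empty product of copies of k. *)
HB.mixin Record isBimodule (k : fieldType) (S : pzRingType)
    (eta : {rmorphism k -> S}) A of GRing.Lmodule S^c A := {
  lact : S -> A -> A;
  lact1 : forall x, lact 1 x = x;
  lactM : forall s t x, lact (s * t) x = lact s (lact t x);
  lactDl : forall s t x, lact (s + t) x = lact s x + lact t x;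
  lactDr : forall s x y, lact s (x + y) = lact s x + lact s y;
  lact_ract : forall s (t : S^c) x, lact s (t *: x) = t *: lact s x;
  lact_central : forall (c : k) x, lact (eta c) x = (eta c : S^c) *: x
}.

#[short(type="bimodType")]
HB.structure Definition Bimodule (k : fieldType) (S : pzRingType)
    (eta : {rmorphism k -> S}) :=
  {A of GRing.Lmodule S^c A & isBimodule k S eta A}.

HB.mixin Record isGradedBimodule (k : fieldType) (S : pzRingType)
    (eta : {rmorphism k -> S}) A
    of GradedRModule S A & Bimodule k eta A := {
  homog_lact : forall i s (x : A),
    homog i x -> homog i (lact s x)
}.

#[short(type="gradedBimodType")]
HB.structure Definition GradedBimodule (k : fieldType) (S : pzRingType)
    (eta : {rmorphism k -> S}) :=
  {A of GradedRModule S A & Bimodule k eta A & isGradedBimodule k S eta A}.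

(* M (x)_S A is the free abelian group on M * A modulo the subgroup generated by
   the biadditivity and balancing relations. *)
Section Tensor.
Variables (k : fieldType) (S : pzRingType) (eta : {rmorphism k -> S}).
Variables (M : lmodType S^c) (A : bimodType eta).

Local Notation gen x y := (<< (x, y) >> : {freeg (M * A)}).

Inductive tensor_rel : {freeg (M * A)} -> Prop :=
| TensorRel0 : tensor_rel 0
| TensorRelB u v : tensor_rel u -> tensor_rel v -> tensor_rel (u - v)
| TensorRelDl x x' y : tensor_rel (gen (x + x') y - (gen x y + gen x' y))
| TensorRelDr x y y' : tensor_rel (gen x (y + y') - (gen x y + gen x y'))
| TensorRelBal x (s : S) y :
    tensor_rel (gen ((s : S^c) *: x) y - gen x (lact s y)).

Definition tensor_ker : {pred {freeg (M * A)}} := fun u => `[< tensor_rel u >].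

Lemma tensor_kerP u : reflect (tensor_rel u) (u \in tensor_ker).
Proof. exact: asboolP. Qed.

Fact tensor_ker_closed : zmod_closed tensor_ker.
Proof.
split=> [|u v /tensor_kerP hu /tensor_kerP hv]; apply/tensor_kerP.
  exact: TensorRel0.
exact: TensorRelB.
Qed.

HB.instance Definition _ :=
  GRing.isZmodClosed.Build {freeg (M * A)} tensor_ker tensor_ker_closed.

Local Notation Q := {ideal_quot tensor_ker}.

Definition tensor := Q.
HB.instance Definition _ := GRing.Zmodule.on tensor.

Definition tens (x : M) (y : A) : tensor := \pi_Q (gen x y).

Definition balanced (P : zmodType) (f : M -> A -> P) : Prop :=
  [/\ forall x x' y, f (x + x') y = f x y + f x' y,
      forall x y y', f x (y + y') = f x y + f x y' &
      forall x (s : S) y, f ((s : S^c) *: x) y = f x (lact s y)].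

Lemma tens_balanced : balanced tens.
Proof.
have tE u v : tensor_rel (u - v) -> \pi_Q u = \pi_Q v.
  by move=> /tensor_kerP uv; apply/eqP; rewrite -Quotient.idealrBE.
split=> [x x' y|x y y'|x s y]; last exact/tE/TensorRelBal.
- by rewrite /tens -(raddfD \pi_Q); apply/tE/TensorRelDl.
- by rewrite /tens -(raddfD \pi_Q); apply/tE/TensorRelDr.
Qed.

Lemma tensor_ind (P : tensor -> Prop) :
  (forall u v, P u -> P v -> P (u - v)) -> (forall x y, P (tens x y)) ->
  forall u, P u.
Proof.
move=> PB Pt; have P0 : P 0 by rewrite -(subrr (tens 0 0)); apply: PB.
have PN u : P u -> P (- u) by rewrite -sub0r; apply: PB.
have PD u v : P u -> P v -> P (u + v).
  by move=> Pu Pv; rewrite -[v]opprK; apply: PB => //; apply: PN.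
move=> u; rewrite -[u]reprK; move: (repr _) => {}u.
rewrite -(freeg_sumE u) raddf_sum; elim/big_ind: _ => // -[x y] _ /=.
rewrite -[coeff _ u]intz -freegU_mulz raddfMz /=.
have Pn n : P (tens x y *+ n) by elim: n => // n; rewrite mulrS; apply: PD.
by case: (coeff _ u) => n; [apply: Pn | rewrite NegzE mulrNz; apply/PN/Pn].
Qed.

Section Lift.
Variables (P : zmodType) (f : M -> A -> P).

(* The universal property of M (x)_S A. *)
Definition tensor_lift (u : tensor) : P :=
  fglift ((fun xy => f xy.1 xy.2) : M * A -> zmodule P) (repr (u : Q)).

Hypothesis f_bal : balanced f.

Local Notation flift :=
  (fglift ((fun xy => f xy.1 xy.2) : M * A -> zmodule P)).

Let flift_gen x y : flift (gen x y) = f x y.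
Proof. by rewrite liftU scale1r. Qed.

Let fliftB u v : flift (u - v) = flift u - flift v.
Proof. exact: lift_is_additive. Qed.

Let flift0 : flift 0 = 0.
Proof. by rewrite -(subrr 0) fliftB subrr. Qed.

Let fliftD u v : flift (u + v) = flift u + flift v.
Proof.
by rewrite -{1}[v]opprK -[- v]sub0r !fliftB flift0 sub0r opprK.
Qed.

Let flift_rel u : tensor_rel u -> flift u = 0.
Proof.
case: f_bal => fDl fDr fS; elim=> {u} [|u v _ hu _ hv|x x' y|x y y'|x s y].
- exact: flift0.
- by rewrite fliftB hu hv subrr.
- by rewrite fliftB fliftD !flift_gen fDl subrr.
- by rewrite fliftB fliftD !flift_gen fDr subrr.
- by rewrite fliftB !flift_gen fS subrr.
Qed.

Let tensor_lift_pi u : tensor_lift (\pi_Q u) = flift u.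
Proof.
apply/eqP; rewrite -subr_eq0 -fliftB; apply/eqP/flift_rel.
by apply/tensor_kerP; rewrite Quotient.idealrBE reprK.
Qed.

Lemma tensor_liftE x y : tensor_lift (tens x y) = f x y.
Proof. by rewrite tensor_lift_pi flift_gen. Qed.

Lemma tensor_liftB u v : tensor_lift (u - v) = tensor_lift u - tensor_lift v.
Proof.
rewrite -[u]reprK -[v]reprK -(raddfB \pi_Q) /= !tensor_lift_pi.
exact: fliftB.
Qed.
End Lift.

(* The right action on M (x)_S A: (x (x) y) s = x (x) (y s). *)
Definition tensor_ract (s : S^c) : tensor -> tensor :=
  tensor_lift (fun x y => tens x (s *: y)).

Let tensor_ract_balanced (s : S^c) : balanced (fun x y => tens x (s *: y)).
Proof.
case: tens_balanced => tDl tDr tS.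
by split=> *; rewrite ?tDl ?scalerDr ?tDr ?tS ?lact_ract.
Qed.

Lemma tensor_ractE s x y : tensor_ract s (tens x y) = tens x (s *: y).
Proof. exact/tensor_liftE/tensor_ract_balanced. Qed.

Let tensor_ractB s : {morph tensor_ract s : u v / u - v}.
Proof. exact/tensor_liftB/tensor_ract_balanced. Qed.

Let tensor_ractA s t u :
  tensor_ract s (tensor_ract t u) = tensor_ract (s * t) u.
Proof.
elim/tensor_ind: u => [u v hu hv|x y]; first by rewrite !tensor_ractB hu hv.
by rewrite !tensor_ractE scalerA.
Qed.

Let tensor_ract1 : left_id 1 tensor_ract.
Proof.
elim/tensor_ind => [u v hu hv|x y]; first by rewrite tensor_ractB hu hv.
by rewrite tensor_ractE scale1r.
Qed.

Let tensor_ractDr : right_distributive tensor_ract +%R.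
Proof.
move=> s u v; have r0 : tensor_ract s 0 = 0.
  by have := tensor_ractB s 0 0; rewrite !subrr.
by rewrite -{1}[v]opprK -[- v]sub0r !tensor_ractB r0 sub0r opprK.
Qed.

Let tensor_ractDl u : {morph tensor_ract^~ u : s t / s + t}.
Proof.
move=> s t; elim/tensor_ind: u => [u v hu hv|x y].
  by rewrite !tensor_ractB hu hv opprD addrACA.
by case: tens_balanced => _ tDr _; rewrite !tensor_ractE scalerDl tDr.
Qed.

HB.instance Definition _ := GRing.Zmodule_isLmodule.Build S^c tensor
  tensor_ractA tensor_ract1 tensor_ractDr tensor_ractDl.

Lemma scale_tens (s : S^c) x y : s *: tens x y = tens x (s *: y).
Proof. exact: tensor_ractE. Qed.
End Tensor.

(* M (x)_S A (x)_S ... (x)_S A, with n factors A, associated to the left. *)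
Fixpoint tpow (k : fieldType) (S : pzRingType) (eta : {rmorphism k -> S})
    (A : bimodType eta) (n : nat) (M : lmodType S^c) : lmodType S^c :=
  if n is n'.+1 then tpow A n' (tensor M A) else M.

(* The pure tensor x (x) a_1 (x) ... (x) a_n. *)
Fixpoint pure (k : fieldType) (S : pzRingType) (eta : {rmorphism k -> S})
    (A : bimodType eta) (M : lmodType S^c) (x : M) (a : seq A) :
    tpow A (size a) M :=
  match a with
  | [::] => x
  | b :: a' => pure (tens x b) a'
  end.

Fixpoint homogs (k : fieldType) (S : pzRingType) (eta : {rmorphism k -> S})
    (A : gradedBimodType eta) (d : seq int) (a : seq A) : Prop :=
  match d, a with
  | [::], [::] => True
  | i :: d', b :: a' => homog i b /\ homogs d' a'
  | _, _ => False
  end.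

(* The usual grading of M (x)_S A (x)_S ... (x)_S A: the degree-p summand is
   spanned by the pure tensors of homogeneous elements of total degree p. *)
Inductive tpow_homog (k : fieldType) (S : pzRingType) (eta : {rmorphism k -> S})
    (A : gradedBimodType eta) (M : gradedRModType S) :
    forall n, int -> tpow A n M -> Prop :=
| TpowHomog0 n p : @tpow_homog k S eta A M n p 0
| TpowHomogD n p (u v : tpow A n M) :
    tpow_homog p u -> tpow_homog p v -> tpow_homog p (u + v)
| TpowHomogPure (i : int) (x : M) (d : seq int) (a : seq A) :
    homog i x -> homogs d a -> tpow_homog (i + \sum_(j <- d) j) (pure x a).

Section Ainf.
Variables (k : fieldType) (S : pzRingType) (eta : {rmorphism k -> S}).

(* A family of right S-linear maps f_n : M (x) A^(x)(n-1) -> N, n >= 1.  The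
   component f_n is [f n.-1]: the argument counts the factors A. *)
Definition tfamily (A : bimodType eta) (M N : lmodType S^c) :=
  forall n : nat, {linear tpow A n M -> N}.

(* f_n (x (x) a_1 (x) ... (x) a_(n-1)), where n - 1 = size a. *)
Definition value (A : bimodType eta) (M N : lmodType S^c) (f : tfamily A M N)
  (x : M) (a : seq A) : N := f (size a) (pure x a).

(* f_n is homogeneous of degree e n, for every n >= 1. *)
Definition tfamily_degree (A : gradedBimodType eta) (M N : gradedRModType S)
    (f : tfamily A M N) (e : nat -> int) : Prop :=
  forall n p (u : tpow A n M), tpow_homog p u -> homog (p + e n.+1) (f n u).

Definition sgn (z : int) : int := (-1) ^+ `|z|%N.

(* m_n (a_1 (x) ... (x) a_n), where n = size a >= 1. *)
Definition avalue (A : bimodType eta) (m : tfamily A A A) (a : seq A) : A :=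
  if a is x :: a' then value m x a' else 0.

(* Equality of maps out of a tensor product is stated on pure tensors of
   homogeneous elements, which span it; there, by the Koszul rule,
   (id^r (x) m_s (x) id^t)(a_1 (x) ... (x) a_n) carries the sign
   (-1)^((2 - s)(|a_1| + ... + |a_r|)). *)
Definition ainf_algebra_eq (A : gradedBimodType eta)
    (m : tfamily A A A) : Prop :=
  forall (d : seq int) (a : seq A), homogs d a -> (0 < size a)%N ->
  let n := size a in
  \sum_(0 <= r < n) \sum_(1 <= s < (n - r).+1)
    (let t := (n - r - s)%N in
     avalue m (take r a ++ avalue m (take s (drop r a)) :: drop (r + s) a)
       *~ sgn ((r + s * t)%N%:Z + (2 - s%:Z) * \sum_(i <- take r d) i)) = 0.

(* [alg_m_lact] is left S-linearity: S acts on A (x) ... (x) A from the left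
   through the first factor. *)
Record ainfAlgebra := AinfAlgebra {
  ainf_alg_sort :> gradedBimodType eta;
  alg_m : tfamily ainf_alg_sort ainf_alg_sort ainf_alg_sort;
  alg_m_lact : forall s x a,
    value alg_m (lact s x) a = lact s (value alg_m x a);
  alg_m_degree : tfamily_degree alg_m (fun n => 2 - n%:Z);
  alg_m_eq : ainf_algebra_eq alg_m
}.

Variable A : ainfAlgebra.

Section Sums.
Variables M N P : gradedRModType S.

(* The value at x (x) a_1 (x) ... (x) a_(n-1), with |x| = i and |a_j| = d_j, of
   \sum_(r+s+t=n; r,s>=1, t>=0) (-1)^(r+st) f_(r+1+t) (id^r (x) m_s (x) id^t). *)
Definition inner_sum (f : tfamily A M N) (i : int) (d : seq int) (x : M)
    (a : seq A) : N :=
  let n := (size a).+1 in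
  \sum_(1 <= r < n) \sum_(1 <= s < (n - r).+1)
    (let t := (n - r - s)%N in
     value f x (take r.-1 a ++ avalue (@alg_m A) (take s (drop r.-1 a))
                  :: drop (r.-1 + s) a)
       *~ sgn ((r + s * t)%N%:Z
               + (2 - s%:Z) * (i + \sum_(j <- take r.-1 d) j))).

(* \sum_(s+t=n; s>=1, t>=0) (-1)^(st) f_(1+t) (m_s (x) id^t), with m on M. *)
Definition outer_sum (f : tfamily A M N) (m : tfamily A M M) (x : M)
    (a : seq A) : N :=
  let n := (size a).+1 in
  \sum_(1 <= s < n.+1)
    (let t := (n - s)%N in
     value f (value m x (take s.-1 a)) (drop s.-1 a) *~ sgn (s * t)%N%:Z).

(* \sum_(r+s=n; r>=1, s>=0) (-1)^(e r s) g_(1+s) (f_r (x) id^s). *)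
Definition comp_sum (e : nat -> nat -> nat) (g : tfamily A N P)
    (f : tfamily A M N) (x : M) (a : seq A) : P :=
  let n := (size a).+1 in
  \sum_(1 <= r < n.+1)
    (let s := (n - r)%N in
     value g (value f x (take r.-1 a)) (drop r.-1 a) *~ sgn (e r s)%:Z).

End Sums.

Definition ainf_module_eq (M : gradedRModType S) (m : tfamily A M M) : Prop :=
  forall i d (x : M) (a : seq A), homog i x -> homogs d a ->
    inner_sum m i d x a + outer_sum m m x a = 0.

Record ainfModule := AinfModule {
  ainf_mod_sort :> gradedRModType S;
  mod_m : tfamily A ainf_mod_sort ainf_mod_sort;
  mod_m_degree : tfamily_degree mod_m (fun n => 2 - n%:Z);
  mod_m_eq : ainf_module_eq mod_m
}.

Definition ainf_morphism_eq (M N : ainfModule) (f : tfamily A M N) : Prop :=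
  forall i d (x : M) (a : seq A), homog i x -> homogs d a ->
    inner_sum f i d x a + outer_sum f (mod_m M) x a
    - comp_sum (fun r s => (r.+1 * s)%N) (mod_m N) f x a = 0.

Record ainfMorphism (M N : ainfModule) := AinfMorphism {
  mor_f :> tfamily A M N;
  mor_f_degree : tfamily_degree mor_f (fun n => 1 - n%:Z);
  mor_f_eq : ainf_morphism_eq mor_f
}.

(* Composites and identities are given by their values on pure tensors, which
   determine them. *)
Definition ainf_comp (M N P : ainfModule) (g : ainfMorphism N P)
    (f : ainfMorphism M N) : M -> seq A -> P :=
  comp_sum (fun r s => (r.+1 * s)%N) g f.

Definition ainf_id (M : ainfModule) (x : M) (a : seq A) : M :=
  if a is [::] then x else 0.

(* F and G are the values on pure tensors of the families to be compared.  The
   relation is linear in h, hence an equivalence, so f is invertible modulo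
   homotopy iff some g satisfies gf ~ id and fg ~ id. *)
Definition homotopic (M N : ainfModule) (F G : M -> seq A -> N) : Prop :=
  exists2 h : tfamily A M N, tfamily_degree h (fun n => - n%:Z) &
  forall i d (x : M) (a : seq A), homog i x -> homogs d a ->
    F x a - G x a = comp_sum (fun r s => (r * s)%N) (mod_m N) h x a
                    + outer_sum h (mod_m M) x a + inner_sum h i d x a.

Definition homotopy_equivalence (M N : ainfModule)
    (f : ainfMorphism M N) : Prop :=
  exists g : ainfMorphism N M,
    homotopic (ainf_comp g f) (@ainf_id M) /\
    homotopic (ainf_comp f g) (@ainf_id N).

Definition mod_d (M : ainfModule) (x : M) : M := mod_m M 0%N x.
Definition mor_1 (M N : ainfModule) (f : ainfMorphism M N) (x : M) : N :=
  mor_f f 0%N x.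

Definition cocycle (M : ainfModule) (i : int) (x : M) : Prop :=
  homog i x /\ mod_d x = 0.

Definition cohomologous (M : ainfModule) (i : int) (x y : M) : Prop :=
  exists2 z : M, homog (i - 1) z & x - y = mod_d z.

(* The map H^i(M) -> H^i(N) induced by f_1 is injective and surjective. *)
Definition quasi_isomorphism (M N : ainfModule) (f : ainfMorphism M N) : Prop :=
  forall i : int,
    (forall x y : M, cocycle i x -> cocycle i y ->
       cohomologous i (mor_1 f x) (mor_1 f y) -> cohomologous i x y) /\
    (forall z : N, cocycle i z ->
       exists2 x : M, cocycle i x & cohomologous i (mor_1 f x) z).

End Ainf.

(* S is isomorphic, as a k-algebra, to k^l for some l. *)
Definition finite_product_of_copies (k : fieldType) (S : pzRingType)
    (eta : {rmorphism k -> S}) : Prop :=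
  exists (l : nat) (phi : {rmorphism S -> {ffun 'I_l -> k}}),
    bijective phi /\ forall c : k, phi (eta c) = [ffun=> c].

(* Main.v *)
Require Import Defs.
From HB Require Import structures.
From mathcomp Require Import all_boot all_order all_algebra ssrAC.
From mathcomp Require Import boolp classical_sets functions ring zify.

(* In the suspended (bar) convention all numerical signs disappear, and families
   f_n : M (x) A^(n-1) -> N form a differential graded category: composition is
   [bcomp], precomposition with the codifferential of the bar construction of A
   is a square-zero derivation [ins b], a module structure m satisfies the
   Maurer-Cartan equation m m + ins b m = 0, and a morphism is a cycle of
   degree 0 for the differential [diff].

   Since S is a product of fields, the cone of f_1 has an S-linear graded
   contraction.  Hence every cycle with values in the cone of f is a boundary:
   its component of lowest arity is killed by composing with the contraction,
   and one iterates on the arity.  For the cycle (0, id) : N -> cone(f) this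
   gives a morphism g and h with id - fg = D h; then (gf - id, hf) : M -> cone(f)
   is a cycle, and its bounding chain is a homotopy from gf to id. *)

Set Implicit Arguments.
Unset Strict Implicit.
Unset Printing Implicit Defensive.

Import GRing.Theory.

Local Open Scope ring_scope.

(** Families are functions on words, [M -> seq A -> N], instead of maps on tensor powers:
    composition and insertion become sums over decompositions of a list, and each arity can be
    changed without touching the others. The universal property of the tensor product serves only to
    pass between the two descriptions.

    The Koszul sign is carried by the everywhere defined operator [sig], so identities between
    families mention no degrees of elements. Comparing with the signs of the definitions is done on
    homogeneous letters, where it reduces to a Boolean identity between parities.

    The cone of [f] is never turned into a module. A family with values in it is a pair, and its
    being closed or a boundary is written out in coordinates.

    The assumption on [S] enters only through [sum_minimal], which provides linear sections of
    surjections of right modules and thereby an [S]-linear contraction. Both uses of the obstruction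
    argument concern the cone of [f] itself; that [g] is a quasi-isomorphism is never called
    upon. *)

(** * Sums over decompositions of a word *)

Section Splittings.
Variables (T : Type) (V : zmodType).
Implicit Types (a p q r : seq T) (u : T).

(* The sum of [f p q] over all decompositions a = p ++ q. *)
Fixpoint spl (f : seq T -> seq T -> V) a : V :=
  f [::] a + if a is u :: a' then spl (fun p => f (u :: p)) a' else 0.

(* The sum of [f p u q] over all decompositions a = p ++ u :: q. *)
Fixpoint pts (f : seq T -> T -> seq T -> V) a : V :=
  if a is u :: a' then f [::] u a' + pts (fun p => f (u :: p)) a' else 0.

Lemma eq_spl f g a :
  (forall p q, p ++ q = a -> f p q = g p q) -> spl f a = spl g a.
Proof.
elim: a f g => [|u a IH] f g fg /=; rewrite fg //; congr (_ + _).
by apply: IH => p q pqa; apply: fg; rewrite /= pqa.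
Qed.

Lemma eq_pts f g a :
  (forall p u q, p ++ u :: q = a -> f p u q = g p u q) -> pts f a = pts g a.
Proof.
elim: a f g => [|u a IH] f g fg //=; rewrite fg //; congr (_ + _).
by apply: IH => p v q pqa; apply: fg; rewrite /= pqa.
Qed.

Lemma splD f g a : spl (fun p q => f p q + g p q) a = spl f a + spl g a.
Proof. by elim: a f g => [|u a IH] f g /=; rewrite ?addr0 // IH addrACA. Qed.

Lemma ptsD f g a :
  pts (fun p u q => f p u q + g p u q) a = pts f a + pts g a.
Proof. by elim: a f g => [|u a IH] f g /=; rewrite ?addr0 // IH addrACA. Qed.


Lemma spl_cat f p u r :
  spl f (p ++ u :: r) = spl (fun p1 p2 => f p1 (p2 ++ u :: r)) p
                        + spl (fun r1 r2 => f (p ++ u :: r1) r2) r.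
Proof.
elim: p f => [|v p IH] f /=; first by rewrite addr0.
by rewrite IH addrA.
Qed.

Lemma pts_cat f p u r :
  pts f (p ++ u :: r) = pts (fun p1 v p2 => f p1 v (p2 ++ u :: r)) p
    + (f p u r + pts (fun r1 v r2 => f (p ++ u :: r1) v r2) r).
Proof.
elim: p f => [|v p IH] f /=; first by rewrite add0r.
by rewrite IH addrA.
Qed.

(** Coassociativity of deconcatenation: cutting twice does not depend on the order of the cuts. It
    becomes associativity of [bcomp]. *)
Lemma spl_spl (f : seq T -> seq T -> seq T -> V) a :
  spl (fun p r => spl (fun p1 p2 => f p1 p2 r) p) a
  = spl (fun p1 r => spl (fun p2 r2 => f p1 p2 r2) r) a.
Proof.
elim: a f => [|u a IH] f //=.
by rewrite addr0 splD IH addrA.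
Qed.

Lemma spl_pts (f : seq T -> T -> seq T -> seq T -> V) a :
  spl (fun p r => pts (fun p1 u p2 => f p1 u p2 r) p) a
  = pts (fun p1 u r => spl (fun p2 r2 => f p1 u p2 r2) r) a.
Proof.
elim: a f => [|u a IH] f //=; first by rewrite addr0.
by rewrite add0r splD IH.
Qed.

Lemma pts_spl (f : seq T -> seq T -> T -> seq T -> V) a :
  spl (fun p r => pts (fun r1 u r2 => f p r1 u r2) r) a
  = pts (fun p u r2 => spl (fun p1 p2 => f p1 p2 u r2) p) a.
Proof.
elim: a f => [|u a IH] f /=; first by rewrite addr0.
by rewrite IH ptsD addr0 addrA.
Qed.

End Splittings.

Lemma spl_sum (T : Type) (V W : zmodType) (h : V -> W) f (a : seq T) :
  h 0 = 0 -> {morph h : x y / x + y} -> h (spl f a) = spl (fun p q =>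
    h (f p q)) a.
Proof.
move=> h0 hD; elim: a f => [|u a IH] f /=; first by rewrite !addr0.
by rewrite hD IH.
Qed.

Lemma pts_sum (T : Type) (V W : zmodType) (h : V -> W) f (a : seq T) :
  h 0 = 0 -> {morph h : x y / x + y} ->
  h (pts f a) = pts (fun p u q => h (f p u q)) a.
Proof. by move=> h0 hD; elim: a f => [|u a IH] f //=; rewrite hD IH. Qed.

Section Exchange.
Variables (T T' : Type) (V : zmodType).

Lemma spl0 (a : seq T) : spl (fun _ _ => 0 : V) a = 0.
Proof. by elim: a => [|u a IH] /=; rewrite ?addr0 // IH addr0. Qed.

Lemma pts0 (a : seq T) : pts (fun _ _ _ => 0 : V) a = 0.
Proof. by elim: a => [|u a IH] //=; rewrite IH addr0. Qed.

Lemma splN f (a : seq T) : spl (fun p q => - f p q : V) a = - spl f a.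
Proof. by rewrite (spl_sum (h := -%R)) ?oppr0 // => x y; rewrite opprD. Qed.

Lemma ptsN f (a : seq T) : pts (fun p u q => - f p u q : V) a = - pts f a.
Proof. by rewrite (pts_sum (h := -%R)) ?oppr0 // => x y; rewrite opprD. Qed.

Lemma exchange_spl (f : seq T -> seq T -> seq T' -> seq T' -> V) a b :
  spl (fun p q => spl (fun r s => f p q r s) b) a
  = spl (fun r s => spl (fun p q => f p q r s) a) b.
Proof.
by elim: b f => [|u b IH] f /=; rewrite splD ?spl0 ?IH.
Qed.

Lemma exchange_pts (f : seq T -> seq T -> seq T' -> T' -> seq T' -> V) a b :
  spl (fun p q => pts (fun r u s => f p q r u s) b) a
  = pts (fun r u s => spl (fun p q => f p q r u s) a) b.
Proof. by elim: b f => [|u b IH] f /=; rewrite ?spl0 ?splD ?IH. Qed.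

Lemma pts_pts (f : seq T -> T -> seq T -> T -> seq T -> V) a :
  pts (fun p u r => pts (fun p1 v p2 => f p1 v p2 u r) p) a
  = pts (fun p1 v r => pts (fun p2 u r2 => f p1 v p2 u r2) r) a.
Proof. by elim: a f => [|u a IH] f //=; rewrite add0r ptsD IH. Qed.
End Exchange.

Lemma spl_map (T T' : Type) (V : zmodType) (h : T -> T') f (a : seq T) :
  spl f (map h a) = spl (fun p q => f (map h p) (map h q)) a :> V.
Proof. by elim: a f => [|u a IH] f //=; rewrite IH. Qed.

Lemma pts_map (T T' : Type) (V : zmodType) (h : T -> T') f (a : seq T) :
  pts f (map h a) = pts (fun p u q => f (map h p) (h u) (map h q)) a :> V.
Proof. by elim: a f => [|u a IH] f //=; rewrite IH. Qed.

Lemma splE (T : Type) (V : zmodType) f (a : seq T) :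
  spl f a = \sum_(0 <= i < (size a).+1) f (take i a) (drop i a) :> V.
Proof.
elim: a f => [|u a IH] f /=; first by rewrite big_nat1 addr0.
by rewrite big_nat_recl //= IH.
Qed.

Lemma ptsE (T : Type) (V : zmodType) (x0 : T) f (a : seq T) :
  pts f a = \sum_(0 <= i < size a) f (take i a) (nth x0 a i) (drop i.+1 a) :> V.
Proof.
elim: a f => [|u a IH] f /=; first by rewrite big_geq.
by rewrite big_nat_recl //= drop0 IH.
Qed.

(** * Signs and parities *)

Definition sg (V : zmodType) (b : bool) (x : V) : V := if b then - x else x.

Lemma sg0 (V : zmodType) b : sg b (0 : V) = 0.
Proof. by case: b; rewrite /= ?oppr0. Qed.

Lemma sgD (V : zmodType) b : {morph @sg V b : x y / x + y}.
Proof. by case: b => x y //=; rewrite opprD. Qed.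

Lemma sgN (V : zmodType) b (x : V) : sg b (- x) = - sg b x.
Proof. by case: b. Qed.

Lemma sg_addb (V : zmodType) b c (x : V) : sg (b (+) c) x = sg b (sg c x).
Proof. by case: b; case: c; rewrite //= opprK. Qed.

Lemma sgK (V : zmodType) b : involutive (@sg V b).
Proof. by move=> x; rewrite -sg_addb addbb. Qed.

Lemma sgZ (R : pzRingType) (V : lmodType R) b (s : R) (x : V) :
  sg b (s *: x) = s *: sg b x.
Proof. by case: b; rewrite //= scalerN. Qed.

Definition par (z : int) : bool := odd `|z|%N.

Lemma mulrz_sgn (V : zmodType) (x : V) z : x *~ sgn z = sg (par z) x.
Proof.
by rewrite /sgn -signr_odd -/(par z); case: (par z);
  rewrite ?expr0 ?expr1 ?mulrN1z ?mulr1z.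
Qed.

Lemma parN m : par (- m) = par m.
Proof. by rewrite /par abszN. Qed.

Lemma par1D m : par (1 + m) = ~~ par m.
Proof.
case: m => [m|[|m]]; first by rewrite /par -PoszD absz_nat.
  by rewrite NegzE subrr.
have -> : 1 + Negz m.+1 = - m.+1%:Z.
  by rewrite NegzE -[m.+2]addn1 PoszD opprD addrCA subrr addr0.
by rewrite NegzE !parN /par !absz_nat /= negbK.
Qed.

Lemma parD m n : par (m + n) = par m (+) par n.
Proof.
have parS p : par (p - 1) = ~~ par p.
  by rewrite -{2}[p](subrK 1) [X in ~~ par X]addrC par1D negbK.
elim/int_rect: m => [|m IH|m IH]; first by rewrite add0r.
- by rewrite -[m.+1]add1n PoszD -addrA !par1D IH addNb.
- by rewrite -[m.+1]addn1 PoszD opprD addrAC !parS IH addNb.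
Qed.

Lemma par_nat (n : nat) : par n%:Z = odd n.
Proof. by []. Qed.

(** * Homogeneous components and the sign operators *)

Section Grading.
Variables (S : pzRingType).

Section One.
Variable M : gradedRModType S.
Implicit Types (x y : M) (c d : int -> M).

Lemma homogN i x : homog i x -> homog i (- x).
Proof. by move=> hx; rewrite -scaleN1r; apply: homogZ. Qed.

Lemma homogB i x y : homog i x -> homog i y -> homog i (x - y).
Proof. by move=> hx hy; apply: homogD => //; apply: homogN. Qed.

Lemma homog_sg i b x : homog i x -> homog i (sg b x).
Proof. by case: b => //; apply: homogN. Qed.

Lemma homog_ind (P : M -> Prop) :
  P 0 -> (forall x y, P x -> P y -> P (x + y)) ->
  (forall i x, homog i x -> P x) -> forall x, P x.
Proof.
move=> P0 PD Ph x; have [r [c [hc ->]]] := homog_span x.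
by elim/big_ind: _ => // i _; apply: Ph (hc i).
Qed.

Definition components x c : Prop :=
  (forall i, homog i (c i)) /\
  exists r, [/\ uniq r, forall i,
    i \notin r -> c i = 0 & x = \sum_(i <- r) c i].

Lemma sum_support (V : zmodType) (c : int -> V) (r r' : seq int) :
  uniq r -> uniq r' -> {subset r <= r'} -> (forall i, i \notin r -> c i = 0) ->
  \sum_(i <- r') c i = \sum_(i <- r) c i.
Proof.
move=> ur ur' rr' c0; rewrite (bigID (mem r)) /= [X in _ + X]big1 ?addr0 //.
rewrite -big_filter; apply/perm_big/uniq_perm => //; first exact: filter_uniq.
move=> i; rewrite mem_filter /=.
by case ri: (i \in r); rewrite //= (rr' _ ri).
Qed.

Lemma components_undup x c r :
  (forall i, homog i (c i)) -> (forall i, i \notin r -> c i = 0) ->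
  x = \sum_(i <- undup r) c i -> components x c.
Proof.
move=> hc c0 ->; split=> //; exists (undup r); split=> //.
  exact: undup_uniq.
by move=> i; rewrite mem_undup; apply: c0.
Qed.

Lemma componentsD x y c d :
  components x c -> components y d -> components (x + y) (fun i => c i + d i).
Proof.
move=> [hc [r [ur c0 ->]]] [hd [r' [ur' d0 ->]]].
apply: (@components_undup _ _ (r ++ r')).
- by move=> i; apply: homogD.
- by move=> i; rewrite mem_cat negb_or => /andP[/c0-> /d0->]; rewrite addr0.
rewrite big_split /=; congr (_ + _); apply/esym/sum_support => //;
  rewrite ?undup_uniq // => i; by rewrite mem_undup mem_cat => ->;
    rewrite ?orbT.
Qed.

Lemma componentsZ s x c :
  components x c -> components (s *: x) (fun i => s *: c i).
Proof.
move=> [hc [r [ur c0 ->]]]; split; first by move=> i; apply: homogZ.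
exists r; split=> // [i /c0->|]; first by rewrite scaler0.
by rewrite scaler_sumr.
Qed.

Lemma components_homog i x :
  homog i x -> components x (fun j => if j == i then x else 0).
Proof.
move=> hx; split; first by move=> j; case: eqP => [->|_] //; apply: homog0.
exists [:: i]; split=> // [j|]; last by rewrite big_seq1 eqxx.
by rewrite inE => /negPf->.
Qed.

Lemma components0 c : components 0 c -> c = fun=> 0.
Proof.
move=> [hc [r [ur c0 e]]]; apply/funext => i.
have [ri|/c0//] := boolP (i \in r).
exact: (homog_free r c ur hc (esym e) i ri).
Qed.

Lemma components_inj x c d : components x c -> components x d -> c = d.
Proof.
move=> xc xd; have := componentsD xc (componentsZ (-1) xd).
rewrite scaleN1r subrr => /components0 cd; apply/funext => i.
by have /(congr1 (fun f => f i)) := cd; rewrite scaleN1r => /subr0_eq.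
Qed.

Lemma components_exist x : exists c, components x c.
Proof.
elim/homog_ind: x => [|x y [c xc] [d yd]|i x hx].
- by eexists; apply: (@components_homog 0 0); apply: homog0.
- by eexists; apply: componentsD xc yd.
- by eexists; apply: components_homog hx.
Qed.

Section Extension.
Variables (V : lmodType S^c) (phi : int -> M -> V).
Hypothesis phiD : forall i x y,
  homog i x -> homog i y -> phi i (x + y) = phi i x + phi i y.
Hypothesis phiZ : forall i s x, homog i x -> phi i (s *: x) = s *: phi i x.

Let phi0 i : phi i 0 = 0.
Proof. by rewrite -(scale0r (0 : M)) phiZ ?scale0r //; apply: homog0. Qed.

(** Components exist but are not given by a function. The value at [x] is therefore chosen as the
    common value of the sums over all component families and all supports, which agree by
    [components_inj] and [sum_support]. It serves to build [tau] and to glue the degreewise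
    contractions of the cone. *)
Lemma graded_extension : exists Phi : M -> V,
  [/\ {morph Phi : x y / x + y}, forall s x, Phi (s *: x) = s *: Phi x &
      forall i x, homog i x -> Phi x = phi i x].
Proof.
have /choice [Phi PhiP] : forall x, exists v, forall c r, components x c ->
    uniq r -> (forall i, i \notin r -> c i = 0) -> v = \sum_(i <- r) phi i (c
      i).
  move=> x; have [c xc] := components_exist x.
  have [hc [r [ur c0 _]]] := xc; exists (\sum_(i <- r) phi i (c i)).
  move=> d r' xd ur' d0; rewrite -(components_inj xc xd) in d0 *.
  have z0 (r1 : seq int) : (forall i, i \notin r1 -> c i = 0) ->
      forall i, i \notin r1 -> phi i (c i) = 0.
    by move=> h i /h->.
  rewrite -(sum_support (r' := undup (r ++ r')) ur _ _ (z0 _ c0)) ?undup_uniq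
    //.
    apply: sum_support (z0 _ d0); rewrite ?undup_uniq // => i.
    by rewrite mem_undup mem_cat => ->; rewrite orbT.
  by move=> i; rewrite mem_undup mem_cat => ->.
have PhiE x c : components x c -> exists r0 : seq int, forall r : seq int,
  {subset r0 <= r} ->
    uniq r -> Phi x = \sum_(i <- r) phi i (c i).
  move=> xc; have [hc [r0 [_ c0 _]]] := xc; exists r0 => r sr ur.
  apply: PhiP => // i ri; apply: c0; apply: contra ri; exact: sr.
exists Phi; split.
- move=> x y; have [[c xc] [d yd]] := (components_exist x, components_exist y).
  have xyc := componentsD xc yd.
  have [[r1 h1] [r2 h2]] := (PhiE _ _ xc, PhiE _ _ yd).
  have [r3 h3] := PhiE _ _ xyc.
  pose r := undup (r1 ++ r2 ++ r3); have ur : uniq r by apply: undup_uniq.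
  rewrite (h1 r) ?(h2 r) ?(h3 r) // -?big_split /=;
    try by move=> i ri; rewrite mem_undup !mem_cat ri ?orbT.
  by apply: eq_bigr => i _; rewrite phiD; [|case: xc|case: yd].
- move=> s x; have [c xc] := components_exist x.
  have [[r1 h1] [r2 h2]] := (PhiE _ _ xc, PhiE _ _ (componentsZ s xc)).
  pose r := undup (r1 ++ r2); have ur : uniq r by apply: undup_uniq.
  rewrite (h1 r) ?(h2 r) //;
    try by move=> i ri; rewrite mem_undup !mem_cat ri ?orbT.
  by rewrite scaler_sumr; apply: eq_bigr => i _; rewrite phiZ //; case: xc.
- move=> i x hx; rewrite (PhiP _ _ [:: i] (components_homog hx)) //.
    by rewrite big_seq1 eqxx.
  by move=> j; rewrite inE => /negPf->.
Qed.
End Extension.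

Lemma tau_exists : exists t : M -> M,
  [/\ {morph t : x y / x + y}, forall s x, t (s *: x) = s *: t x &
      forall i x, homog i x -> t x = sg (par i) x].
Proof.
apply: (graded_extension (phi := fun i => @sg M (par i))) =>
  [i x y _ _|i s x _].
  exact: sgD.
exact: sgZ.
Qed.

(* x |-> (-1)^|x| x. *)
Definition tau : M -> M := projT1 (cid tau_exists).

Lemma tauD : {morph tau : x y / x + y}.
Proof. by rewrite /tau; case: cid => t []. Qed.

Lemma tauZ s x : tau (s *: x) = s *: tau x.
Proof. by rewrite /tau; case: cid => t []. Qed.

Lemma tau_homog i x : homog i x -> tau x = sg (par i) x.
Proof. by rewrite /tau; case: cid => t /= [tD tZ th] hx; apply: th. Qed.

Lemma tau0 : tau 0 = 0.
Proof. by rewrite (tau_homog (homog0 0)). Qed.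

Lemma tauN x : tau (- x) = - tau x.
Proof. by rewrite -!scaleN1r tauZ. Qed.

Lemma tauK : involutive tau.
Proof.
elim/homog_ind => [|x y xE yE|i x hx]; first by rewrite !tau0.
  by rewrite !tauD xE yE.
by rewrite (tau_homog hx) (tau_homog (homog_sg _ hx)) sgK.
Qed.

Lemma homog_tau i x : homog i x -> homog i (tau x).
Proof. by move=> hx; rewrite (tau_homog hx); apply: homog_sg. Qed.

Definition taun (n : nat) x : M := if odd n then tau x else x.

Lemma taunD n : {morph taun n : x y / x + y}.
Proof. by rewrite /taun => x y; case: odd => //; apply: tauD. Qed.

Lemma taunZ n s x : taun n (s *: x) = s *: taun n x.
Proof. by rewrite /taun; case: odd => //; apply: tauZ. Qed.

Lemma taunK n : involutive (taun n).
Proof. by rewrite /taun => x; case: odd => //; apply: tauK. Qed.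

Lemma homog_taun n i x : homog i x -> homog i (taun n x).
Proof. by rewrite /taun; case: odd => //; apply: homog_tau. Qed.

Lemma taun_homog n i x : homog i x -> taun n x = sg (odd n && par i) x.
Proof. by rewrite /taun => hx; case: odd => //; apply: tau_homog. Qed.

(* The Koszul sign operator of the suspension. *)
Definition sig x : M := - tau x.

Lemma sigD : {morph sig : x y / x + y}.
Proof. by move=> x y; rewrite /sig tauD opprD. Qed.

Lemma sigZ s x : sig (s *: x) = s *: sig x.
Proof. by rewrite /sig tauZ scalerN. Qed.

Lemma sigK : involutive sig.
Proof. by move=> x; rewrite /sig tauN opprK tauK. Qed.

Lemma homog_sig i x : homog i x -> homog i (sig x).
Proof. by move=> hx; apply/homogN/homog_tau. Qed.

Lemma sig_homog i x : homog i x -> sig x = sg (~~ par i) x.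
Proof. by rewrite /sig => /tau_homog->; case: par; rewrite //= opprK. Qed.

End One.

Variables (k : fieldType) (eta : {rmorphism k -> S}) (A : gradedBimodType eta).

Lemma lact0r s : lact s (0 : A) = 0.
Proof. by apply: (addIr (lact s (0 : A))); rewrite -lactDr !add0r. Qed.

Lemma lactN s (u : A) : lact s (- u) = - lact s u.
Proof. by apply/eqP; rewrite -subr_eq0 opprK -lactDr addNr lact0r. Qed.

Lemma tau_lact s (u : A) : tau (lact s u) = lact s (tau u).
Proof.
elim/homog_ind: u => [|x y xE yE|i x hx].
- by rewrite tau0 lact0r tau0.
- by rewrite lactDr !tauD xE yE lactDr.
- rewrite (tau_homog hx) (tau_homog (homog_lact i s x hx)).
  by case: (par i) => //=; rewrite lactN.
Qed.

Lemma taun_lact n s (u : A) : taun n (lact s u) = lact s (taun n u).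
Proof. by rewrite /taun; case: odd => //; apply: tau_lact. Qed.

Lemma sig_lact s (u : A) : sig (lact s u) = lact s (sig u).
Proof. by rewrite /sig tau_lact lactN. Qed.

End Grading.

Arguments tau {S M} x.
Arguments taun {S M} n x.
Arguments sig {S M} x.
Arguments sigK {S M} x.

Lemma homDE (T U : Type) (V : zmodType) (F G : T -> U -> V) x a :
  (F + G) x a = F x a + G x a.
Proof. by []. Qed.

Lemma homNE (T U : Type) (V : zmodType) (F : T -> U -> V) x a :
  (- F) x a = - F x a.
Proof. by []. Qed.

(** * Multilinear families on words and their composition *)

Section Multilinear.
Variables (k : fieldType) (S : pzRingType) (eta : {rmorphism k -> S}).
Variable A : bimodType eta.

(* [F x a] is the value at x (x) a_1 (x) ... (x) a_n of a family of right
   S-linear maps on M (x)_S A (x)_S ... (x)_S A. *)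
Record mlin (M N : lmodType S^c) (F : M -> seq A -> N) : Prop := Mlin {
  mlinDl : forall x y a, F (x + y) a = F x a + F y a;
  mlinDr : forall x p u v q,
    F x (p ++ (u + v) :: q) = F x (p ++ u :: q) + F x (p ++ v :: q);
  mlinB0 : forall x (s : S) v q,
    F ((s : S^c) *: x) (v :: q) = F x (lact s v :: q);
  mlinB : forall x p u (s : S) v q,
    F x (p ++ ((s : S^c) *: u) :: v :: q) = F x (p ++ u :: lact s v :: q);
  mlinZ0 : forall x s, F (s *: x) [::] = s *: F x [::];
  mlinZ : forall x p u s, F x (p ++ [:: s *: u]) = s *: F x (p ++ [:: u])
}.

Section Consequences.
Variables (M N : lmodType S^c) (F : M -> seq A -> N).
Hypothesis mF : mlin F.

Lemma mlin0l a : F 0 a = 0.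
Proof. by apply: (addIr (F 0 a)); rewrite -(mlinDl mF) !add0r. Qed.

Lemma mlinNl x a : F (- x) a = - F x a.
Proof.
by apply: (addIr (F x a)); rewrite -(mlinDl mF) !addNr mlin0l.
Qed.

Lemma mlin0r x p q : F x (p ++ 0 :: q) = 0.
Proof. by apply: (addIr (F x (p ++ 0 :: q))); rewrite -(mlinDr mF) !add0r. Qed.

Lemma mlinNr x p u q : F x (p ++ - u :: q) = - F x (p ++ u :: q).
Proof.
by apply: (addIr (F x (p ++ u :: q))); rewrite -(mlinDr mF) !addNr mlin0r.
Qed.

Lemma mlin_sgl b x a : F (sg b x) a = sg b (F x a).
Proof. by case: b; rewrite //= mlinNl. Qed.

Lemma mlin_sgr b x p u q : F x (p ++ sg b u :: q) = sg b (F x (p ++ u :: q)).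
Proof. by case: b; rewrite //= mlinNr. Qed.

Lemma mlinDr2 x p w p' u v q : F x (p ++ w :: p' ++ (u + v) :: q)
  = F x (p ++ w :: p' ++ u :: q) + F x (p ++ w :: p' ++ v :: q).
Proof. by rewrite -!cat_cons !catA (mlinDr mF). Qed.

Lemma mlinB2 x p w p' u (s : S) v q :
  F x (p ++ w :: p' ++ ((s : S^c) *: u) :: v :: q)
  = F x (p ++ w :: p' ++ u :: lact s v :: q).
Proof. by rewrite -!cat_cons !catA (mlinB mF). Qed.

Lemma mlinZ2 x p w p' u s :
  F x (p ++ w :: p' ++ [:: s *: u]) = s *: F x (p ++ w :: p' ++ [:: u]).
Proof. by rewrite -!cat_cons !catA (mlinZ mF). Qed.
End Consequences.

Lemma mlinD (M N : lmodType S^c) (F G : M -> seq A -> N) :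
  mlin F -> mlin G -> mlin (F + G).
Proof.
move=> mF mG; split=> *; rewrite !homDE.
- by rewrite (mlinDl mF) (mlinDl mG) addrACA.
- by rewrite (mlinDr mF) (mlinDr mG) addrACA.
- by rewrite (mlinB0 mF) (mlinB0 mG).
- by rewrite (mlinB mF) (mlinB mG).
- by rewrite (mlinZ0 mF) (mlinZ0 mG) scalerDr.
- by rewrite (mlinZ mF) (mlinZ mG) scalerDr.
Qed.

Lemma mlinN (M N : lmodType S^c) (F : M -> seq A -> N) : mlin F -> mlin (- F).
Proof.
move=> mF; split=> *; rewrite !homNE.
- by rewrite (mlinDl mF) opprD.
- by rewrite (mlinDr mF) opprD.
- by rewrite (mlinB0 mF).
- by rewrite (mlinB mF).
- by rewrite (mlinZ0 mF) scalerN.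
- by rewrite (mlinZ mF) scalerN.
Qed.

Definition bcomp (M N : Type) (V : zmodType) (G : N -> seq A -> V)
    (F : M -> seq A -> N) (x : M) (a : seq A) : V :=
  spl (fun p q => G (F x p) q) a.

Lemma mlin_comp (M N P : lmodType S^c) (G : N -> seq A -> P)
  (F : M -> seq A -> N) : mlin G -> mlin F -> mlin (bcomp G F).
Proof.
move=> mG mF; split=> [x y a|x p u v q|x s v q|x p u s v q|x s|x p u s];
  rewrite /bcomp.
- by rewrite -splD; apply: eq_spl => p q _; rewrite (mlinDl mF) (mlinDl mG).
- rewrite !spl_cat addrACA -!splD; congr (_ + _); apply: eq_spl => p1 p2 _.
    by rewrite (mlinDr mG).
  by rewrite (mlinDr mF) (mlinDl mG).
- rewrite /= (mlinZ0 mF) (mlinB0 mG); congr (_ + _).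
  by apply: eq_spl => p1 p2 _; rewrite (mlinB0 mF).
- rewrite !spl_cat /= (mlinZ mF) (mlinB0 mG).
  congr (_ + (_ + _)); apply: eq_spl => p1 p2 _; first by rewrite (mlinB mG).
  by rewrite (mlinB mF).
- by rewrite /= !addr0 (mlinZ0 mF) (mlinZ0 mG).
- rewrite !spl_cat /= !addr0 (mlinZ mF) (mlinZ0 mG) scalerDr; congr (_ + _).
  rewrite (spl_sum (h := fun y => s *: y)) ?scaler0 //; last exact: scalerDr.
  by apply: eq_spl => p1 p2 _; rewrite (mlinZ mG).
Qed.
End Multilinear.

(** * Insertion of the structure maps of the algebra *)

Section Insertion.
Variables (k : fieldType) (S : pzRingType) (eta : {rmorphism k -> S}).
Variable A : gradedBimodType eta.

Variable b : A -> seq A -> A.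
Hypothesis mb : mlin b.
Hypothesis b_lact : forall s u q, b (lact s u) q = lact s (b u q).

(** Precomposition with the bar codifferential. A nonempty block [u :: q] is passed to [b] as an
    element and a word, [A] being a right module over itself. Everything to the left of the block
    receives [sig], because [b] has degree 1. *)
Definition ins (M : gradedRModType S) (V : zmodType) (F : M -> seq A -> V)
    (x : M) (a : seq A) : V :=
  pts (fun p u => spl (fun q r => F (sig x) (map sig p ++ b u q :: r))) a.

(** A balancing relation between neighbouring letters is checked according to the position of the
    block. If the block ends between them, right linearity of [b] releases the scalar; if it starts
    between them, [b_lact] does. *)
Lemma mlin_ins (M : gradedRModType S) (N : lmodType S^c) (F : M -> seq A -> N) :
  mlin F -> mlin (ins F).
Proof.
move=> mF; split=> [x y a|x p u v q|x s v q|x p u s v q|x s|x p u s];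
  rewrite /ins.
- rewrite -ptsD; apply: eq_pts => p u q _; rewrite -splD.
  by apply: eq_spl => p1 p2 _; rewrite sigD (mlinDl mF).
- rewrite !pts_cat ![_ + (_ + _) + (_ + _)]addrACA.
  rewrite -ptsD addrACA -!splD -ptsD; congr (_ + (_ + _)).
  + apply: eq_pts => p1 w p2 _; rewrite !spl_cat addrACA -!splD.
    congr (_ + _); apply: eq_spl => q1 q2 _; first by rewrite (mlinDr2 mF).
    by rewrite (mlinDr mb) (mlinDr mF).
  + by apply: eq_spl => q1 q2 _; rewrite (mlinDl mb) (mlinDr mF).
  + apply: eq_pts => p1 w p2 _; rewrite -!splD; apply: eq_spl => q1 q2 _.
    by rewrite !map_cat /= sigD -!catA !cat_cons (mlinDr mF).
- rewrite /=; congr (_ + _).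
    by apply: eq_spl => p1 p2 _; rewrite sigZ (mlinB0 mF) b_lact.
  apply: eq_pts => p1 w p2 _; apply: eq_spl => q1 q2 _.
  by rewrite sigZ /= (mlinB0 mF) sig_lact.
- rewrite !pts_cat /=; congr (_ + (_ + (_ + _))).
  + apply: eq_pts => p1 w p2 _; rewrite !spl_cat /=.
    congr (_ + (_ + _)).
    * by apply: eq_spl => q1 q2 _; rewrite (mlinB2 mF).
    * by rewrite (mlinZ mb) (mlinB mF).
    * by apply: eq_spl => q1 q2 _; rewrite (mlinB mb).
  + congr (_ + _); first by rewrite (mlinZ0 mb) (mlinB mF).
    by apply: eq_spl => q1 q2 _; rewrite (mlinB0 mb).
  + apply: eq_spl => q1 q2 _; rewrite !map_cat /= sigZ -!catA /= (mlinB mF).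
    by rewrite b_lact.
  + apply: eq_pts => p1 w p2 _; apply: eq_spl => q1 q2 _.
    by rewrite !map_cat /= sigZ -!catA /= (mlinB mF) sig_lact.
- by rewrite /= scaler0.
- have sD : {morph (fun y : N => s *: y) : y z / y + z} by exact: scalerDr.
  have s0 := scaler0 N s.
  rewrite !pts_cat /= !addr0 scalerDr; congr (_ + _).
    rewrite (pts_sum (h := fun y => s *: y)) //.
    apply: eq_pts => p1 w p2 _; rewrite !spl_cat /= !addr0 scalerDr.
    congr (_ + _); last by rewrite (mlinZ mb) (mlinZ mF).
    rewrite (spl_sum (h := fun y => s *: y)) //.
    by apply: eq_spl => q1 q2 _; rewrite (mlinZ2 mF).
  by rewrite (mlinZ0 mb) (mlinZ mF).
Qed.
End Insertion.

(** * Suspended degrees *)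

Section Degrees.
Variables (k : fieldType) (S : pzRingType) (eta : {rmorphism k -> S}).
Variable A : gradedBimodType eta.

(* [hword n a]: the letters of a are homogeneous, and n is the degree of
   a_1 (x) ... (x) a_n in the suspended grading. *)
Fixpoint hword (n : int) (a : seq A) : Prop :=
  if a is u :: a' then exists2 i, homog i u & hword (n - (i - 1)) a'
  else n = 0.

Lemma hword_cat n p q :
  hword n (p ++ q) <-> exists2 m, hword m p & hword (n - m) q.
Proof.
elim: p n => [|u p IH] n /=.
  split=> [h|[_ -> ]]; first by exists 0; rewrite ?subr0.
  by rewrite subr0.
split=> [[i hu /IH [m hp hq]]|[m [i hu hp] hq]].
  exists (m + (i - 1)); first by exists i; rewrite // addrK.
  by move: hq; rewrite -addrA -opprD [m + _]addrC.
exists i => //; apply/IH; exists (m - (i - 1)) => //.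
by rewrite [X in hword X](_ : _ = n - m) //; ring.
Qed.

Lemma hword_sig n p : hword n p -> hword n (map sig p).
Proof.
by elim: p n => [|u p IH] n //= [i hu /IH hp]; exists i => //; apply: homog_sig.
Qed.

Section Additive.
Variables (M : gradedRModType S) (V : zmodType) (F : M -> seq A -> V).
Hypothesis FDl : forall x y a, F (x + y) a = F x a + F y a.
Hypothesis FDr : forall x p u v q,
  F x (p ++ (u + v) :: q) = F x (p ++ u :: q) + F x (p ++ v :: q).

Lemma additive_ext :
  (forall i n x a, homog i x -> hword n a -> F x a = 0) -> forall x a,
    F x a = 0.
Proof.
move=> Fh.
have F0 x p q : F x (p ++ 0 :: q) = 0.
  by apply: (addIr (F x (p ++ 0 :: q))); rewrite -FDr !add0r.
(* The prefix [p] consists of letters already known to be homogeneous; the letters of [a] are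
   decomposed and moved to it one at a time, and [x] is decomposed last. *)
have Fx a p n x : hword n p -> F x (p ++ a) = 0.
  elim: a p n x => [|u a IH] p n x hp.
    rewrite cats0; elim/homog_ind: x => [|x y Fx Fy|i x hx].
    - by apply: (addIr (F 0 p)); rewrite -FDl !add0r.
    - by rewrite FDl Fx Fy addr0.
    - exact: Fh hx hp.
  elim/homog_ind: u => [|u v Fu Fv|i u hu]; first exact: F0.
    by rewrite FDr Fu Fv addr0.
  rewrite -cat_rcons -cats1; apply: (IH _ (n + (i - 1))).
  by apply/hword_cat; exists n => //=; exists i; rewrite // addrAC addrK subrr.
by move=> x a; apply: (Fx a [::] 0).
Qed.
End Additive.

(** The suspensions of [M] and [N] cancel, so only the letters are shifted. Components of degree e +
    1 - n give suspended degree [e]: 1 for structure maps, 0 for morphisms, -1 for homotopies. *)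
Definition fdeg (e : int) (M N : gradedRModType S) (F : M -> seq A -> N) :=
  forall i n x a, homog i x -> hword n a -> homog (i + n + e) (F x a).

Lemma spl_homog (N : gradedRModType S) j (f : seq A -> seq A -> N) a :
  (forall p q, p ++ q = a -> homog j (f p q)) -> homog j (spl f a).
Proof.
elim: a f => [|u a IH] f hf /=; apply: homogD.
- exact: hf.
- exact: homog0.
- exact: hf.
- by apply: IH => p q pq; apply: hf; rewrite /= pq.
Qed.

Lemma pts_homog (N : gradedRModType S) j (f : seq A -> A -> seq A -> N) a :
  (forall p u q, p ++ u :: q = a -> homog j (f p u q)) -> homog j (pts f a).
Proof.
elim: a f => [|u a IH] f hf /=; first exact: homog0.
apply: homogD; first exact: hf.
by apply: IH => p v q pq; apply: hf; rewrite /= pq.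
Qed.

Lemma fdegD e (M N : gradedRModType S) (F G : M -> seq A -> N) :
  fdeg e F -> fdeg e G -> fdeg e (F + G).
Proof. by move=> dF dG i n x a hx ha; apply: homogD; [apply: dF|apply: dG]. Qed.

Lemma fdegN e (M N : gradedRModType S) (F : M -> seq A -> N) :
  fdeg e F -> fdeg e (- F).
Proof. by move=> dF i n x a hx ha; apply: homogN; apply: dF. Qed.

Lemma fdeg_comp e e' (M N P : gradedRModType S) (G : N -> seq A -> P)
  (F : M -> seq A -> N) : fdeg e G -> fdeg e' F -> fdeg (e + e') (bcomp G F).
Proof.
move=> dG dF i n x a hx ha; apply: spl_homog => p q pq.
move: ha; rewrite -pq => /hword_cat [m hp hq].
have := dG _ _ _ _ (dF _ _ _ _ hx hp) hq.
by congr (homog _ _); ring.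
Qed.

Lemma sig_word (M : gradedRModType S) (V : zmodType) (F : M -> seq A -> V) x
    n p a :
  (forall x p u q, F x (p ++ - u :: q) = - F x (p ++ u :: q)) ->
  hword n a -> F x (p ++ map sig a) = sg (par n) (F x (p ++ a)).
Proof.
move=> FN; elim: a n p => [|u a IH] n p /=; first by move->.
move=> [i hu ha]; rewrite (sig_homog hu) -cat_rcons (IH _ _ ha) cat_rcons.
have -> : F x (p ++ sg (~~ par i) u :: a) = sg (~~ par i) (F x (p ++ u :: a)).
  by case: (~~ _) => //=; apply: FN.
rewrite -sg_addb !parD !parN parD; congr (sg _ _).
by rewrite /(par 1) /= addbT addbK.
Qed.

Section Parity.
Variables (M N : gradedRModType S) (F : M -> seq A -> N).
Hypothesis mF : mlin F.

(** [sig] is the sign of the suspended degree, and applying it to [x] and to every letter gives the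
    sign of the whole input, which [F] shifts by [e]. The signs in [ins_comp] and [ins_ins] come
    from here. *)
Lemma parity e x a : fdeg e F ->
  sig (F x a) = sg (par e) (F (sig x) (map sig a)).
Proof.
move=> dF; apply/eqP; rewrite -subr_eq0; apply/eqP.
pose H y c := sig (F y c) - sg (par e) (F (sig y) (map sig c)).
apply: (@additive_ext _ _ H) => [y z c|y p u v q|i n y c hy hc]; rewrite /H.
- by rewrite sigD !(mlinDl mF) sigD sgD opprD addrACA.
- by rewrite !map_cat /= sigD !(mlinDr mF) sigD sgD opprD addrACA.
- rewrite (sig_homog (dF _ _ _ _ hy hc)) (sig_homog hy) (mlin_sgl mF).
  rewrite (sig_word _ [::] _ hc); last exact: mlinNr.
  rewrite /= -!sg_addb !parD.
  by case: (par i); case: (par n); case: (par e); rewrite /= subrr.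
Qed.
End Parity.

End Degrees.

Lemma hom_sgE (T U : Type) (V : zmodType) c (F : T -> U -> V) x a :
  (sg c F) x a = sg c (F x a).
Proof. by case: c. Qed.

(** * Insertion is a square-zero derivation *)

Section Composition.
Variables (k : fieldType) (S : pzRingType) (eta : {rmorphism k -> S}).
Variable A : gradedBimodType eta.


Lemma bcompDl (M N : Type) (V : zmodType) (G G' : N -> seq A -> V)
  (F : M -> seq A -> N) : bcomp (G + G') F = bcomp G F + bcomp G' F.
Proof. by apply/funext => x; apply/funext => a; apply: splD. Qed.

Lemma bcompNl (M N : Type) (V : zmodType) (G : N -> seq A -> V)
  (F : M -> seq A -> N) : bcomp (- G) F = - bcomp G F.
Proof. by apply/funext => x; apply/funext => a; apply: splN. Qed.

Section Right.
Variables (N P : lmodType S^c) (G : N -> seq A -> P).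
Hypothesis mG : mlin G.

Lemma bcompDr (M : Type) (F F' : M -> seq A -> N) :
  bcomp G (F + F') = bcomp G F + bcomp G F'.
Proof.
apply/funext => x; apply/funext => a; rewrite /bcomp !homDE -splD.
by apply: eq_spl => p q _; rewrite homDE (mlinDl mG).
Qed.

Lemma bcompNr (M : Type) (F : M -> seq A -> N) :
  bcomp G (- F) = - bcomp G F.
Proof.
apply/funext => x; apply/funext => a; rewrite /bcomp !homNE -splN.
by apply: eq_spl => p q _; rewrite homNE (mlinNl mG).
Qed.

Lemma bcompA (L M : Type) (F : M -> seq A -> N) (E : L -> seq A -> M) :
  bcomp G (bcomp F E) = bcomp (bcomp G F) E.
Proof.
apply/funext => x; apply/funext => a; rewrite /bcomp.
rewrite -(spl_spl (fun p q r => G (F (E x p) q) r)).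
apply: eq_spl => p q _.
rewrite (spl_sum (h := fun y => G y q)) ?(mlin0l mG) // => y z.
exact: mlinDl.
Qed.
End Right.

Variable b : A -> seq A -> A.

Lemma insD (M : gradedRModType S) (V : zmodType) (F G : M -> seq A -> V) :
  ins b (F + G) = ins b F + ins b G.
Proof.
apply/funext => x; apply/funext => a; rewrite /ins !homDE -ptsD.
by apply: eq_pts => p u y _; rewrite -splD.
Qed.

Lemma insN (M : gradedRModType S) (V : zmodType) (F : M -> seq A -> V) :
  ins b (- F) = - ins b F.
Proof.
apply/funext => x; apply/funext => a; rewrite /ins !homNE -ptsN.
by apply: eq_pts => p u y _; rewrite -splN.
Qed.

Hypothesis db : fdeg 1 b.

Lemma fdeg_ins e (M N : gradedRModType S) (F : M -> seq A -> N) :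
  fdeg e F -> fdeg (e + 1) (ins b F).
Proof.
move=> dF i n x a hx ha; apply: pts_homog => p u y py.
apply: spl_homog => q r qr; move: ha; rewrite -py -qr.
move=> /hword_cat [m /hword_sig hp [j hu /hword_cat [l hq hr]]].
have := dF _ (n + 1) _ (map sig p ++ b u q :: r) (homog_sig hx).
rewrite (_ : i + (n + 1) + e = i + n + (e + 1)); last by ring.
apply; apply/hword_cat; exists m => //=; exists (j + l + 1); first exact: db.
by rewrite [X in hword X](_ : _ = n - m - (j - 1) - l) //; ring.
Qed.

(** The cut made by the composition lies on one side of the inserted letter. If it lies to the left,
    the letter belongs to the word of [G], and moving the [sig] operators through [F] costs the sign
    of [e]. *)
Lemma ins_comp (M N P : gradedRModType S) e (G : N -> seq A -> P)
  (F : M -> seq A -> N) : mlin G -> mlin F -> fdeg e F ->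
  ins b (bcomp G F) = bcomp G (ins b F) + sg (par e) (bcomp (ins b G) F).
Proof.
move=> mG mF dF; apply/funext => x; apply/funext => a.
rewrite homDE hom_sgE addrC.
transitivity (pts (fun p u y => spl (fun q r =>
    spl (fun p1 p2 => G (F (sig x) (map sig p1)) (map sig p2 ++ b u q :: r)) p
    + spl (fun r1 r2 => G (F (sig x) (map sig p ++ b u q :: r1)) r2) r) y) a).
  apply: eq_pts => p u y _; apply: eq_spl => q r _.
  by rewrite /bcomp spl_cat spl_map.
under eq_pts => p u y _ do rewrite splD.
rewrite ptsD; congr (_ + _).
  under eq_pts => p u y _ do rewrite exchange_spl.
  rewrite -(pts_spl (fun p1 p2 u y => spl (fun q r =>
    G (F (sig x) (map sig p1)) (map sig p2 ++ b u q :: r)) y)).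
  rewrite /bcomp (spl_sum (h := @sg P (par e))) ?sg0 //; last exact: sgD.
  apply: eq_spl => p q _; rewrite /ins.
  rewrite (pts_sum (h := @sg P (par e))) ?sg0 //; last exact: sgD.
  apply: eq_pts => r1 u r2 _.
  rewrite (spl_sum (h := @sg P (par e))) ?sg0 //; last exact: sgD.
  apply: eq_spl => s1 s2 _.
  by rewrite (parity mF _ _ dF) (mlin_sgl mG) -sg_addb addbb.
under eq_pts => p u y _.
  rewrite -(spl_spl (fun q r1 r2 => G (F (sig x) (map sig p ++ b u q ::
    r1)) r2)).
  over.
rewrite -(spl_pts (fun p u y r2 => spl (fun q r1 =>
  G (F (sig x) (map sig p ++ b u q :: r1)) r2) y)).
apply: eq_spl => p r _; rewrite /ins.
have GD : {morph (fun z => G z r) : y z / y + z} by move=> y z; apply: mlinDl.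
rewrite (pts_sum (h := fun z => G z r)) ?(mlin0l mG) //.
apply: eq_pts => p1 u p2 _.
by rewrite (spl_sum (h := fun z => G z r)) ?(mlin0l mG).
Qed.

Hypothesis mb : mlin b.
Hypothesis bb : bcomp b b + ins b b = 0.

(** Disjoint insertions occur in both orders with opposite signs, since [b] is odd. Nested ones add
    up to the insertion of [bcomp b b + ins b b], which vanishes. *)
Lemma ins_ins (M : gradedRModType S) (N : lmodType S^c) (F : M -> seq A -> N) :
  mlin F -> ins b (ins b F) = 0.
Proof.
move=> mF; apply/funext => x; apply/funext => a.
transitivity (pts (fun p u y => spl (fun q r =>
    pts (fun p1 v p2 =>
      spl (fun s t => F x (p1 ++ b (sig v) (map sig s) :: map sig t ++ b u q ::
        r)) p2
      + spl (fun r1 r2 => F x (p1 ++ b (sig v) (map sig p2 ++ b u q :: r1) ::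
          r2)) r)
      p
    + (spl (fun s t => F x (p ++ b (b u q) s :: t)) r
       + pts (fun r1 v r2 => spl (fun s t =>
           F x (p ++ sig (b u q) :: map sig r1 ++ b v s :: t)) r2) r)) y) a).
  apply: eq_pts => p u y _; apply: eq_spl => q r _.
  rewrite {1}/ins pts_cat pts_map sigK; congr (_ + (_ + _)).
  - apply: eq_pts => p1 v p2 _; rewrite spl_cat spl_map.
    by congr (_ + _); apply: eq_spl => s t _; rewrite (mapK sigK).
  - by apply: eq_spl => s t _; rewrite (mapK sigK).
  - apply: eq_pts => p1 v p2 _; apply: eq_spl => s t _.
    by rewrite map_cat (mapK sigK) /= -catA.
(* The second block lies to the left of the first one ([T1]), starts to its left and contains its
   value ([T2]), starts with that value ([T3]), or lies to its right ([T4]). *)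
pose L p1 v s t u q r :=
  F x (p1 ++ b (sig v) (map sig s) :: map sig t ++ b u q :: r).
pose K p1 v p2 u q r1 r2 :=
  F x (p1 ++ b (sig v) (map sig p2 ++ b u q :: r1) :: r2).
pose T1 := pts (fun p u y => spl (fun q r => pts (fun p1 v p2 =>
  spl (fun s t => L p1 v s t u q r) p2) p) y) a.
pose T2 := pts (fun p u y => spl (fun q r => pts (fun p1 v p2 =>
  spl (fun r1 r2 => K p1 v p2 u q r1 r2) r) p) y) a.
pose T3 := pts (fun p u y => spl (fun q r =>
  spl (fun s t => F x (p ++ b (b u q) s :: t)) r) y) a.
pose T4 := pts (fun p u y => spl (fun q r => pts (fun r1 v r2 =>
  spl (fun s t => F x (p ++ sig (b u q) :: map sig r1 ++ b v s ::
    t)) r2) r) y) a.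
transitivity ((T1 + T4) + (T2 + T3)).
  rewrite addrACA [T4 + T3]addrC -!ptsD; apply: eq_pts => p u y _.
  by rewrite -!splD; apply: eq_spl => q r _; rewrite ptsD.
have -> : T1 = - T4.
  rewrite -ptsN /T1.
  under eq_pts => p u y _ do rewrite exchange_pts.
  rewrite (pts_pts (fun p1 v p2 u y => spl (fun q r => spl (fun s t =>
    L p1 v s t u q r) p2) y)).
  apply: eq_pts => p1 v z _.
  under eq_pts => p2 u y _ do rewrite exchange_spl.
  rewrite -(pts_spl (fun s t u y => spl (fun q r => L p1 v s t u q r) y)).
  rewrite -splN; apply: eq_spl => s R _; rewrite -ptsN; apply: eq_pts =>
    t u y _.
  rewrite -splN; apply: eq_spl => q r _; rewrite /L.
  by rewrite (parity mb _ _ db) /= (mlinNr mF) opprK.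
rewrite addNr add0r.
have -> : T2 = pts (fun p u y => spl (fun q r => F x (p ++ ins b b u q ::
  r)) y) a.
  rewrite /T2; under eq_pts => p u y _ do rewrite exchange_pts.
  rewrite (pts_pts (fun p1 v p2 u y => spl (fun q r => spl (fun r1 r2 =>
    K p1 v p2 u q r1 r2) r) y)).
  apply: eq_pts => p1 v z _.
  under eq_pts => p2 u y _.
    rewrite -(spl_spl (fun q r1 r2 => K p1 v p2 u q r1 r2)).
    over.
  rewrite -(spl_pts (fun p2 u y r2 => spl (fun q r1 =>
    K p1 v p2 u q r1 r2) y)).
  apply: eq_spl => q r _; rewrite /ins.
  have FD : {morph (fun w => F x (p1 ++ w :: r)) : w w' / w + w'}.
    by move=> w w'; apply: mlinDr.
  rewrite (pts_sum (h := fun w => F x (p1 ++ w :: r))) ?(mlin0r mF) //.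
  apply: eq_pts => p2 u p3 _.
  by rewrite (spl_sum (h := fun w => F x (p1 ++ w :: r))) ?(mlin0r mF).
have -> : T3 = pts (fun p u y => spl (fun q r => F x (p ++ bcomp b b u q ::
  r)) y) a.
  apply: eq_pts => p u y _.
  rewrite -(spl_spl (fun q s t => F x (p ++ b (b u q) s :: t))).
  apply: eq_spl => q r _; rewrite /bcomp.
  rewrite (spl_sum (h := fun w => F x (p ++ w :: r))) ?(mlin0r mF) //.
  by move=> w w'; apply: mlinDr.
rewrite -ptsD -[RHS](pts0 _ a); apply: eq_pts => p u y _.
rewrite -splD -[RHS](spl0 _ y); apply: eq_spl => q r _.
rewrite -(mlinDr mF) -[X in p ++ X :: r]homDE addrC bb; exact: mlin0r.
Qed.
End Composition.

(** * The complex of families between two modules *)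

Section Differential.
Variables (k : fieldType) (S : pzRingType) (eta : {rmorphism k -> S}).
Variables (A : gradedBimodType eta) (b : A -> seq A -> A).
Hypotheses (mb : mlin b) (db : fdeg 1 b) (bb : bcomp b b + ins b b = 0).
Hypothesis b_lact : forall s u q, b (lact s u) q = lact s (b u q).

Record bmod (M : gradedRModType S) (m : M -> seq A -> M) : Prop := Bmod {
  bmod_mlin : mlin m;
  bmod_deg : fdeg 1 m;
  bmod_eq : bcomp m m + ins b m = 0
}.

(* The differential of the morphism complex, at an element whose degree has
   parity c. *)
Definition diff (M N : gradedRModType S) (m : M -> seq A -> M)
    (n : N -> seq A -> N) (c : bool) (F : M -> seq A -> N) : M -> seq A -> N :=
  bcomp n F + sg (~~ c) (bcomp F m + ins b F).

Section Diff.
Variables (M N : gradedRModType S) (m : M -> seq A -> M) (n : N -> seq A -> N).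
Hypotheses (bm : bmod m) (bn : bmod n).
Let mm := bmod_mlin bm.
Let mn := bmod_mlin bn.
Let dm := bmod_deg bm.
Let dn := bmod_deg bn.

Lemma mlin_sg (P Q : lmodType S^c) c (F : P -> seq A -> Q) :
  mlin F -> mlin (sg c F).
Proof. by case: c => //; apply: mlinN. Qed.

Lemma fdeg_sg e (P Q : gradedRModType S) c (F : P -> seq A -> Q) :
  fdeg e F -> fdeg e (sg c F).
Proof. by case: c => //; apply: fdegN. Qed.

Lemma mlin_diff c F : mlin F -> mlin (diff m n c F).
Proof.
move=> mF; apply: mlinD; first exact: mlin_comp.
by apply/mlin_sg/mlinD; [apply: mlin_comp|apply: mlin_ins].
Qed.

Lemma fdeg_diff c e F : fdeg e F -> fdeg (e + 1) (diff m n c F).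
Proof.
move=> dF; apply: fdegD; first by rewrite addrC; apply: fdeg_comp.
by apply/fdeg_sg/fdegD; [apply: fdeg_comp|apply: fdeg_ins].
Qed.

Lemma diffD c F G : diff m n c (F + G) = diff m n c F + diff m n c G.
Proof.
by rewrite /diff bcompDl insD (bcompDr mn) [X in sg _ X]addrACA sgD addrACA.
Qed.

Lemma diffN c F : diff m n c (- F) = - diff m n c F.
Proof.
by rewrite /diff bcompNl insN (bcompNr mn) -opprD sgN -opprD.
Qed.

Lemma ins_bmod (P : gradedRModType S) (p : P -> seq A -> P) :
  bmod p -> ins b p = - bcomp p p.
Proof. by move=> /bmod_eq /eqP; rewrite addrC addr_eq0 => /eqP. Qed.

Lemma diff_diff e F : mlin F -> fdeg e F ->
  diff m n (~~ par e) (diff m n (par e) F) = 0.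
Proof.
move=> mF dF; have mI := mlin_ins mb b_lact mF.
have par1 : par 1 = true by [].
rewrite /diff !bcompDl !insD !(bcompDr mn) negbK.
case: (par e) (ins_comp b mn mF dF) => /= In;
  rewrite ?bcompNl ?insN ?(bcompNr mn) !bcompDl !(bcompDr mn) !insD In
          (ins_comp b mF mm dm) (ins_ins db mb bb mF) par1 /=
          (ins_bmod bm) (ins_bmod bn) ?bcompNl ?(bcompNr mF) !(bcompA mn)
          !(bcompA mF) !opprD ?opprK ?oppr0 ?addr0 ?addrA.
(* Ten composites remain once the Maurer-Cartan equations have replaced [ins b m] and [ins b n]; the
   permutation puts each next to its negative. *)
all: rewrite (ACl ((1*8)*(2*4)*(3*7)*(5*9)*(6*10))) /=.
all: by rewrite ?subrr ?addNr ?addr0.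
Qed.
End Diff.

Lemma ins_closed (M N : gradedRModType S) (m : M -> seq A -> M)
  (n : N -> seq A -> N) (f : M -> seq A -> N) :
  diff m n false f = 0 -> ins b f = bcomp n f - bcomp f m.
Proof.
move=> /eqP; rewrite /diff /= opprD addrA subr_eq0 => /eqP->.
by [].
Qed.

Section Closed.
Variables (L M N : gradedRModType S).
Variables (l : L -> seq A -> L) (m : M -> seq A -> M) (n : N -> seq A -> N).
Hypotheses (bl : bmod l) (bm : bmod m) (bn : bmod n).
Let mn := bmod_mlin bn.

Lemma diff_compr c (f : L -> seq A -> M) (h : M -> seq A -> N) :
  mlin f -> fdeg 0 f -> diff l m false f = 0 -> mlin h ->
  diff l n c (bcomp h f) = bcomp (diff m n c h) f.
Proof.
move=> mf df /ins_closed If mh.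
rewrite /diff (ins_comp b mh mf df) If (bcompDr mh) (bcompNr mh) !(bcompA mh).
rewrite (bcompA mn) bcompDl.
rewrite [X in sg _ X]addrA [X in sg _ (X + _)]addrC subrK.
by case: c; rewrite /= ?bcompNl bcompDl.
Qed.

Lemma diff_compl e (f : M -> seq A -> N) (G : L -> seq A -> M) :
  mlin f -> diff m n false f = 0 -> mlin G -> fdeg e G ->
  diff l n (par e) (bcomp f G) = bcomp f (diff l m (par e) G).
Proof.
move=> mf /ins_closed If mG dG.
rewrite /diff (ins_comp b mf mG dG) If !bcompDl bcompNl (bcompDr mf).
rewrite (bcompA mn) (bcompA mf).
case: (par e); rewrite /= ?(bcompNr mf) (bcompDr mf) !(bcompA mf).
all: rewrite ?opprD ?opprK !addrA ?opprD ?opprK ?addrA.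
all: by rewrite [LHS](ACl ((1*4)*(5*2*3))) /= subrr add0r.
Qed.
End Closed.
End Differential.

Lemma spl_last (T : Type) (V : zmodType) (f : seq T -> seq T -> V) a :
  (forall p u q, p ++ u :: q = a -> f p (u :: q) = 0) -> spl f a = f a [::].
Proof.
elim: a f => [|u a IH] f f0 /=; first by rewrite addr0.
rewrite (f0 [::]) // add0r; apply: IH => p v q pq; apply: f0.
by rewrite /= pq.
Qed.

Lemma spl_first (T : Type) (V : zmodType) (f : seq T -> seq T -> V) a :
  (forall u p q, u :: p ++ q = a -> f (u :: p) q = 0) -> spl f a = f [::] a.
Proof.
case: a => [|u a] f0 /=; first by rewrite addr0.
rewrite (_ : spl _ a = 0) ?addr0 // -[RHS](spl0 _ a).
by apply: eq_spl => p q pq; apply: f0; rewrite pq.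
Qed.

(** * Obstruction theory, arity by arity *)

Section Limits.
Variables (k : fieldType) (S : pzRingType) (eta : {rmorphism k -> S}).
Variables (A : gradedBimodType eta).

(** Each relation in [mlin] compares words of one length, so a different family may be used in every
    arity. This makes the arity-wise corrections and their limit multilinear. *)
Lemma mlin_graded (M N : lmodType S^c) (F : nat -> M -> seq A -> N) :
  (forall n, mlin (F n)) -> mlin (fun x a => F (size a) x a).
Proof.
move=> mF; split=> *; rewrite ?size_cat /=.
- exact: mlinDl.
- exact: mlinDr.
- exact: mlinB0.
- exact: mlinB.
- exact: mlinZ0.
- exact: mlinZ.
Qed.

Lemma mlin0 (M N : lmodType S^c) : mlin (0 : M -> seq A -> N).
Proof. by split=> *; rewrite /GRing.zero /= ?addr0 ?scaler0. Qed.

Lemma fdeg0 e (M N : gradedRModType S) : fdeg e (0 : M -> seq A -> N).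
Proof. by move=> i n x a _ _; apply: homog0. Qed.
End Limits.

Section Obstruction.
Variables (k : fieldType) (S : pzRingType) (eta : {rmorphism k -> S}).
Variables (A : gradedBimodType eta) (b : A -> seq A -> A).
Hypotheses (mb : mlin b) (db : fdeg 1 b) (bb : bcomp b b + ins b b = 0).
Hypothesis b_lact : forall s u q, b (lact s u) q = lact s (b u q).

(** The blocks of length one are the only ones that preserve the number of letters, hence the only
    ones that see the lowest arity of [F]. *)
Definition ins1 (M : gradedRModType S) (V : zmodType) (F : M -> seq A -> V)
    (x : M) (a : seq A) : V :=
  pts (fun p u q => F (sig x) (map sig p ++ b u [::] :: q)) a.

Section Leading.
Variables (M N : gradedRModType S) (m : M -> seq A -> M) (n : N -> seq A -> N).
Hypothesis mn : mlin n.
Variables (c : bool) (F : M -> seq A -> N) (j : nat).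
Hypothesis F0 : forall x a, (size a < j)%N -> F x a = 0.

Lemma bcomp_lead (P : lmodType S^c) (G : N -> seq A -> P) x a :
  mlin G -> (size a <= j)%N -> bcomp G F x a = G (F x a) [::].
Proof.
move=> mG aj; apply: spl_last => p u q pq.
rewrite F0 ?(mlin0l mG) //; apply: leq_trans aj.
by rewrite -pq size_cat /= addnS ltnS leq_addr.
Qed.

(** All other terms evaluate [F] on fewer than [j] letters: higher components of [m] and [b] consume
    letters, and those of [n] keep letters for themselves. What remains is the differential built
    from the linear parts. *)
Lemma diff_lead x a : (size a <= j)%N ->
  diff b m n c F x a = n (F x a) [::] + sg (~~ c) (F (m x [::]) a + ins1 F x a).
Proof.
move=> aj; rewrite /diff homDE hom_sgE homDE bcomp_lead //.
congr (_ + sg _ (_ + _)).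
  apply: spl_first => u p q pq; apply: F0; apply: leq_trans aj.
  by rewrite -pq /= size_cat ltnS leq_addl.
apply: eq_pts => p u y py; apply: spl_first => v q r qr.
apply: F0; apply: leq_trans aj.
by rewrite -py -qr !size_cat /= size_map size_cat; lia.
Qed.

Lemma diff_below x a : (size a < j)%N -> diff b m n c F x a = 0.
Proof.
move=> aj; rewrite diff_lead 1?ltnW // !F0 // (mlin0l mn) add0r add0r.
rewrite /ins1 (_ : pts _ a = 0) ?sg0 // -[RHS](pts0 _ a).
apply: eq_pts => p u q pq; apply: F0; apply: leq_ltn_trans aj.
by rewrite -pq !size_cat size_map.
Qed.
End Leading.

Variables (L M N : gradedRModType S).
Variables (l : L -> seq A -> L) (m : M -> seq A -> M) (n : N -> seq A -> N).
Hypotheses (bl : bmod b l) (bm : bmod b m) (bn : bmod b n).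
Variable f : M -> seq A -> N.
Hypotheses (mf : mlin f) (df : fdeg 0 f) (cf : diff b m n false f = 0).

Let mm := bmod_mlin bm.
Let mn := bmod_mlin bn.

Let K : lmodType S^c := (M * N)%type.

(* The differential of the cone of f_1. *)
Definition cone_d (z : M * N) : M * N :=
  (- m z.1 [::], f z.1 [::] + n z.2 [::]).

Variable h : M * N -> M * N.
Hypothesis hD : {morph h : y z / y + z}.
Hypothesis hZ : forall (s : S^c) (z : K), h (s *: z) = s *: (h z : K).
Hypothesis h_homog : forall i x y, homog (i + 1) x -> homog i y ->
  homog i (h (x, y)).1 /\ homog (i - 1) (h (x, y)).2.
Hypothesis h_contr : forall z, cone_d (h z) + h (cone_d z) = z.

Let h0 : h 0 = 0.
Proof. by apply: (addIr (h 0)); rewrite -hD !add0r. Qed.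

Let hsg c z : h (sg c z) = sg c (h z).
Proof.
case: c => //=; apply: (addIr (h z)).
by rewrite -hD !addNr h0.
Qed.

Variables (e : int) (F1 : L -> seq A -> M) (F2 : L -> seq A -> N).
Hypotheses (mF1 : mlin F1) (dF1 : fdeg e F1).
Hypotheses (mF2 : mlin F2) (dF2 : fdeg (e - 1) F2).
Hypothesis cF1 : diff b l m (par e) F1 = 0.
Hypothesis cF2 : bcomp f F1 + diff b l n (~~ par e) F2 = 0.

Let H := ((L -> seq A -> M) * (L -> seq A -> N))%type.

(** The cycle minus the boundary of [G] in the families with values in the cone. The differential on
    the shifted summand [M] is negated, which turns the first difference into a sum. *)
Let res (G : H) : H :=
  (F1 + diff b l m (~~ par e) G.1,
   F2 - (bcomp f G.1 + diff b l n (par e) G.2)).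

Let good (G : H) : Prop :=
  [/\ mlin G.1, fdeg (e - 1) G.1, mlin G.2 & fdeg (e - 2) G.2].

Let par1 : par (e - 1) = ~~ par e.
Proof. by rewrite parD addbT. Qed.

Let par2 : par (e - 2) = par e.
Proof. by rewrite parD addbF. Qed.

Let res_good G : good G ->
  [/\ mlin (res G).1, fdeg e (res G).1,
    mlin (res G).2 & fdeg (e - 1) (res G).2].
Proof.
move=> [mG1 dG1 mG2 dG2]; split=> /=.
- by apply: mlinD => //; apply: mlin_diff.
- apply: fdegD => //; rewrite -[e](subrK 1).
  by apply: fdeg_diff.
- apply: mlinD => //; apply/mlinN/mlinD; first exact: mlin_comp.
  exact: mlin_diff.
- apply: fdegD => //; apply/fdegN/fdegD; first by rewrite -[e - 1]add0r; apply:
    fdeg_comp.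
  by rewrite (_ : e - 1 = e - 2 + 1); [apply: fdeg_diff|ring].
Qed.

Let res_closed G : good G -> diff b l m (par e) (res G).1 = 0 /\
  bcomp f (res G).1 + diff b l n (~~ par e) (res G).2 = 0.
Proof.
move=> [mG1 dG1 mG2 dG2]; split; rewrite /=.
  rewrite (diffD l bm) cF1 add0r -[X in diff _ _ _ X _]negbK -par1.
  exact: diff_diff.
rewrite (bcompDr mf) (diffD l bn) (diffN l bn) (diffD l bn) addrACA cF2 add0r.
rewrite -[X in diff b l n (~~ X) (diff _ _ _ _ _)]par2.
rewrite -[X in diff b l n X (diff _ _ _ _ _)]/(~~ par (e - 2)).
rewrite -[in diff _ _ _ (par e) G.2]par2.
rewrite (diff_diff mb db bb b_lact bl bn mG2 dG2) addr0 -par1.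
by rewrite (diff_compl l bn mf cf mG1 dG1) subrr.
Qed.

Let R (G : H) x a : M * N := ((res G).1 x a, (res G).2 x a).

Let cor1 (j : nat) (G : H) x a :
  M := if size a == j then (h (R G x a)).1 else 0.
Let cor2 (j : nat) (G : H) x a :
  N := if size a == j then (h (R G x a)).2 else 0.

Let step (j : nat) (G : H) : H := (G.1 + cor1 j G, G.2 + cor2 j G).

Let ins1_pair (U V : zmodType) (G1 : L -> seq A -> U) (G2 :
  L -> seq A -> V) x a :
  ins1 (V := (U * V)%type) (fun x a => (G1 x a, G2 x a)) x a
  = (ins1 G1 x a, ins1 G2 x a).
Proof.
rewrite [LHS]surjective_pairing; congr (_, _).
  by rewrite (pts_sum (h := fst)).
by rewrite (pts_sum (h := snd)).
Qed.

Let mlin_pair (P : lmodType S^c) (g : K -> P) (E1 : L -> seq A -> M)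
  (E2 : L -> seq A -> N) :
  (forall y z, g (y + z) = g y + g z) -> (forall (s : S^c) z, g (s *: z) = s *:
    g z) ->
  mlin E1 -> mlin E2 -> mlin (fun x a => g (E1 x a, E2 x a)).
Proof.
move=> gD gZ m1 m2; split=> *.
- by rewrite -gD (mlinDl m1) (mlinDl m2).
- by rewrite -gD (mlinDr m1) (mlinDr m2).
- by rewrite (mlinB0 m1) (mlinB0 m2).
- by rewrite (mlinB m1) (mlinB m2).
- by rewrite -gZ (mlinZ0 m1) (mlinZ0 m2).
- by rewrite -gZ (mlinZ m1) (mlinZ m2).
Qed.

Let step_good j G : good G -> good (step j G).
Proof.
move=> gG; have [mG1 dG1 mG2 dG2] := gG; have [m1 d1 m2 d2] := res_good gG.
split=> /=.
- apply: mlinD => //.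
  apply: (mlin_graded (F := fun i x a =>
    if i == j then (h (R G x a)).1 else 0)).
  move=> i; case: eqP => _; last exact: mlin0.
  by apply: (mlin_pair (g := fun z => (h z).1)) => // y z; rewrite ?hD ?hZ.
- apply: fdegD => // i n' x a hx ha; rewrite /cor1; case: eqP => _; last exact:
    homog0.
  have [//|//|] := h_homog (i := i + n' + (e - 1)) (x := (res G).1 x a) (y :=
    (res G).2 x a).
  + by rewrite -addrA subrK; apply: d1.
  + exact: d2.
  + by [].
- apply: mlinD => //.
  apply: (mlin_graded (F := fun i x a =>
    if i == j then (h (R G x a)).2 else 0)).
  move=> i; case: eqP => _; last exact: mlin0.
  by apply: (mlin_pair (g := fun z => (h z).2)) => // y z; rewrite ?hD ?hZ.
- apply: fdegD => // i n' x a hx ha; rewrite /cor2; case: eqP => _; last exact: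
    homog0.
  have [//|//|_] := h_homog (i := i + n' + (e - 1)) (x := (res G).1 x a) (y :=
    (res G).2 x a).
  + by rewrite -addrA subrK; apply: d1.
  + exact: d2.
  + by rewrite (_ : i + n' + (e - 1) - 1 = i + n' + (e - 2)) //; ring.
Qed.

Let res_step G T1 T2 : res (G.1 + T1, G.2 + T2) =
  ((res G).1 + diff b l m (~~ par e) T1,
   (res G).2 - (bcomp f T1 + diff b l n (par e) T2)).
Proof.
rewrite /res /= (diffD l bm) (diffD l bn) (bcompDr mf) addrA; congr (_, _).
by rewrite -[RHS]addrA -opprD addrACA.
Qed.

(** In arity [j] only linear differentials act on the residue [R], and closedness expresses
    [cone_d R] through [R] at the differentiated argument. Since [h] acts on values alone, it
    commutes with that precomposition. The boundary of the correction [h R] is thus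
    [cone_d (h R) + h (cone_d R)], which equals [R]. *)
Let step_res j G : good G -> (forall x a, (size a < j)%N -> R G x a = 0) ->
  forall x a, (size a < j.+1)%N -> R (step j G) x a = 0.
Proof.
move=> gG R0 x a; rewrite ltnS => aj.
have [m1 d1 m2 d2] := res_good gG; have [c1 c2] := res_closed gG.
have R10 y c : (size c < j)%N -> (res G).1 y c = 0.
  by move=> /(R0 y) /(congr1 fst).
have R20 y c : (size c < j)%N -> (res G).2 y c = 0.
  by move=> /(R0 y) /(congr1 snd).
have T10 y c : (size c < j)%N -> cor1 j G y c = 0.
  by rewrite /cor1 ltn_neqAle => /andP[/negPf->].
have T20 y c : (size c < j)%N -> cor2 j G y c = 0.
  by rewrite /cor2 ltn_neqAle => /andP[/negPf->].
have -> : R (step j G) x a =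
    ((res G).1 x a + diff b l m (~~ par e) (cor1 j G) x a,
     (res G).2 x a - (bcomp f (cor1 j G) x a + diff b l n (par e) (cor2 j G) x
       a)).
  by rewrite /R /step res_step.
rewrite (diff_lead l mm _ T10) // (diff_lead l mn _ T20) // (bcomp_lead T10) //.
case: (ltngtP (size a) j) aj => // [aj|aj] _.
  rewrite R10 // R20 // !T10 // !T20 //.
  rewrite !(mlin0l mm) !(mlin0l mn) (mlin0l mf) !add0r /ins1.
  rewrite (eq_pts (g := fun _ _ _ => 0)); last first.
    by move=> p u q pq; apply: T10; rewrite size_cat size_map -size_cat; move:
      aj; rewrite -pq !size_cat.
  rewrite pts0 sg0 (eq_pts (g := fun _ _ _ => 0)); last first.
    by move=> p u q pq; apply: T20; rewrite size_cat size_map -size_cat; move: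
      aj; rewrite -pq !size_cat.
  by rewrite pts0 sg0 ?addr0 ?oppr0 ?addr0.
(* [X] is the residue precomposed with the linear differential of L (x) A (x) ... (x) A. *)
pose X := R G (l x [::]) a + ins1 (R G) x a.
have dX : cone_d (R G x a) = sg (~~ par e) X.
  rewrite /cone_d /R /X ins1_pair.
  move: (congr1 (fun F => F x a) c1) (congr1 (fun F => F x a) c2).
  rewrite homDE (diff_lead l mm _ R10) ?aj // (diff_lead l mn _ R20) ?aj //.
  rewrite (bcomp_lead R10) ?aj // negbK addrA.
  move=> /eqP; rewrite addr_eq0 => /eqP -> /eqP; rewrite addr_eq0 => /eqP ->.
  by case: (par e); rewrite /= ?opprK.
have TX : ((cor1 j G (l x [::]) a + ins1 (cor1 j G) x a),
           (cor2 j G (l x [::]) a + ins1 (cor2 j G) x a)) = h X.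
  rewrite /X hD.
  have hi : h (ins1 (R G) x a) = ins1 (fun x a => h (R G x a)) x a.
    exact: pts_sum.
  rewrite hi [in RHS](_ : (fun x a => h (R G x a)) =
     fun x a => ((h (R G x a)).1, (h (R G x a)).2)); last first.
    by apply/funext => y; apply/funext => c; apply: surjective_pairing.
  rewrite ins1_pair [h (R G (l x [::]) a)]surjective_pairing /cor1 /cor2 aj
    eqxx.
  by congr (_ + _, _ + _); apply: eq_pts => p u q pq;
    rewrite size_cat size_map -aj -pq size_cat /= eqxx.
have E1 : cor1 j G x a = (h (R G x a)).1 by rewrite /cor1 aj eqxx.
have E2 : cor2 j G x a = (h (R G x a)).2 by rewrite /cor2 aj eqxx.
have := h_contr (R G x a); rewrite dX hsg -TX /cone_d -E1 -E2 negbK.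
move: (cor1 j G (l x [::]) a + _) (cor2 j G (l x [::]) a + _) => Y1 Y2 RE.
rewrite -[(res G).1 x a]/((R G x a).1) -[(res G).2 x a]/((R G x a).2) -RE.
case: (par e) => /=; congr (_, _).
- by rewrite addrACA addNr subrr addr0.
- by rewrite [X in _ - X]addrA subrr.
- by rewrite addrACA !addNr addr0.
- by rewrite [X in _ - X]addrA subrr.
Qed.

Let sol (j : nat) : H := iteri j step (0, 0).

Let sol_good j : good (sol j).
Proof.
elim: j => [|j IH]; last exact: step_good.
by split; [apply: mlin0|apply: fdeg0|apply: mlin0|apply: fdeg0].
Qed.

Let sol_res j x a : (size a < j)%N -> R (sol j) x a = 0.
Proof.
elim: j x a => // j IH; apply: step_res => //; exact: sol_good.
Qed.

Let sol_stable i j x a : (size a < i <= j)%N ->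
  (sol j).1 x a = (sol i).1 x a /\ (sol j).2 x a = (sol i).2 x a.
Proof.
move=> /andP[ai]; elim: j => [|j IH]; first by case: i ai.
rewrite leq_eqVlt => /orP[/eqP->//|ij]; have [<- <-] := IH ij.
have aj : size a == j = false by apply/negP => /eqP; lia.
by rewrite /= !homDE /cor1 /cor2 aj !addr0.
Qed.

(** The hypotheses [cF1] and [cF2] say that (F1, F2) is a cycle of degree [e] with values in the
    cone of [f]; the conclusion says that it is the boundary of (G1, G2). *)
Lemma obstruction : exists (G1 : L -> seq A -> M) (G2 : L -> seq A -> N),
  [/\ mlin G1 /\ fdeg (e - 1) G1, mlin G2 /\ fdeg (e - 2) G2,
      F1 = - diff b l m (~~ par e) G1 &
      F2 = bcomp f G1 + diff b l n (par e) G2].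
Proof.
(* Step [i] alters only words of length [i], so the value at [a] is final after [(size a).+1]
   steps. *)
pose G1 x a := (sol (size a).+1).1 x a; pose G2 x a := (sol (size a).+1).2 x a.
have good_sol j := sol_good j.
exists G1, G2.
have RG x a : R (G1, G2) x a = 0.
  have := sol_res x (ltnSn (size a)); rewrite /R /res /= => <-.
  set j := (size a).+1.
  (* The limit is the approximation [sol j] plus a remainder vanishing on words shorter than [j],
     which does not affect the residue at [a]. *)
  have G1E : G1 = (sol j).1 + (G1 - (sol j).1) by rewrite addrCA subrr addr0.
  have G2E : G2 = (sol j).2 + (G2 - (sol j).2) by rewrite addrCA subrr addr0.
  have D1 y c : (size c < j)%N -> (G1 - (sol j).1) y c = 0.
    move=> cj; rewrite homDE homNE /G1.
    have cj1 : (size c < (size c).+1 <= j)%N by rewrite ltnSn.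
    by have [-> _] := sol_stable y cj1; rewrite subrr.
  have D2 y c : (size c < j)%N -> (G2 - (sol j).2) y c = 0.
    move=> cj; rewrite homDE homNE /G2.
    have cj1 : (size c < (size c).+1 <= j)%N by rewrite ltnSn.
    by have [_ ->] := sol_stable y cj1; rewrite subrr.
  rewrite [in LHS]G1E [in LHS]G2E (diffD l bm) (diffD l bn) (bcompDr mf).
  rewrite !homDE !homNE !homDE (diff_below l mm _ D1) // (diff_below l mn _ D2)
    //.
  by rewrite (bcomp_lead D1) // D1 // (mlin0l mf) !addr0.
split.
- split; first by apply: (mlin_graded (F := fun i => (sol i.+1).1)) => i; case:
    (good_sol i.+1).
  by move=> i d x a hx ha; case: (good_sol (size a).+1) => _ h1 _ _; apply: h1.
- split; first by apply: (mlin_graded (F := fun i => (sol i.+1).2)) => i; case: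
    (good_sol i.+1).
  by move=> i d x a hx ha; case: (good_sol (size a).+1) => _ _ _ h1; apply: h1.
- apply/funext => x; apply/funext => a; apply/eqP;
    rewrite -subr_eq0 homNE opprK.
  by have /(congr1 fst) /= := RG x a; rewrite homDE => ->.
- apply/funext => x; apply/funext => a; apply/eqP; rewrite -subr_eq0.
  by apply/eqP; exact: (congr1 snd (RG x a)).
Qed.
End Obstruction.

(** * Linear selections from semisimplicity *)

(* 1 is a finite sum of elements E_j generating minimal right ideals. *)
Definition sum_minimal (S : pzRingType) : Prop :=
  exists (l : nat) (E : 'I_l -> S), \sum_j E j = 1 /\
    forall j s, E j * s = 0 \/ exists t, E j * s * t = E j.

Lemma product_sum_minimal (k : fieldType) (S : pzRingType)
  (eta : {rmorphism k -> S}) : finite_product_of_copies eta -> sum_minimal S.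
Proof.
move=> [l [phi [[g gK phiK] _]]].
have phi_inj : injective phi := can_inj gK.
exists l, (fun j => g [ffun i => (i == j)%:R]); split.
  apply: phi_inj; rewrite rmorph1 rmorph_sum /=; apply/ffunP => i.
  rewrite sum_ffunE ffunE (bigD1 i) //= phiK ffunE eqxx big1 ?addr0 // => j ji.
  by rewrite phiK ffunE eq_sym (negPf ji).
move=> j s; have [s0|s0] := eqVneq (phi s j) 0.
  left; apply: phi_inj; rewrite rmorphM rmorph0 phiK; apply/ffunP => i.
  rewrite !ffunE; case: eqP => [->|_]; last by rewrite mul0r.
  by rewrite s0 mulr0.
(* Only coordinate [j] survives multiplication by [E j], so the constant function inverting [s]
   there suffices. *)
right; exists (g [ffun=> (phi s j)^-1]); apply: phi_inj.
rewrite !rmorphM !phiK; apply/ffunP => i; rewrite !ffunE.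
case: eqP => [->|_]; last by rewrite !mul0r.
by rewrite mul1r divff.
Qed.

Section Selection.
Variable S : pzRingType.
Hypothesis hS : sum_minimal S.
Variables (U V : lmodType S^c) (R : U -> V -> Prop).
Hypothesis R0 : R 0 0.
Hypothesis RD : forall u v u' v', R u v -> R u' v' -> R (u + u') (v + v').
Hypothesis RZ : forall s u v, R u v -> R (s *: u) (s *: v).

Record partial_selection (G : set (U * V)) : Prop := PartialSelection {
  psel_sub : forall u v, G (u, v) -> R u v;
  psel_add : forall u v u' v', G (u, v) -> G (u', v') -> G (u + u', v + v');
  psel_scale : forall s u v, G (u, v) -> G (s *: u, s *: v);
  psel_fun : forall v, G (0, v) -> v = 0
}.

(** Zorn on graphs of partial linear selections. If a maximal graph misses [u], it misses some [E j]
    multiple of [u], because the [E j] sum to 1. That multiple generates a simple submodule, which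
    meets the domain only in 0, so the graph extends to it. *)
Lemma selection_relation : exists2 G, partial_selection G &
  forall u v, R u v -> exists v', G (u, v').
Proof.
have [F FP Ftot|G [pG maxG]] := @Zorn_bigcup (U * V)%type partial_selection.
  have dir p q : (\bigcup_(X in F) X)%classic p -> (\bigcup_(X in
    F) X)%classic q ->
      exists2 X, F X & X p /\ X q.
    move=> [X FX Xp] [Y FY Yq]; case: (Ftot _ _ FX FY) => XY.
      by exists Y => //; split=> //; apply: XY.
    by exists X => //; split=> //; apply: XY.
  split.
  - by move=> u v [X /FP pX]; apply: psel_sub.
  - move=> u v u' v' h h'; have [X FX [X1 X2]] := dir _ _ h h'.
    by exists X => //; apply: psel_add => //; apply: FP.
  - by move=> s u v [X FX Xuv]; exists X => //; apply: psel_scale => //; apply: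
      FP.
  - by move=> v [X /FP pX]; apply: psel_fun.
exists G => //.
have max G' : partial_selection G' -> (forall p, G p -> G' p) -> forall p,
  G' p -> G p.
  move=> pG' sub p G'p; apply: contrapT => nGp; apply: (maxG G') => //.
  by split=> // sub'; apply: nGp; apply: sub'.
(* The empty chain has empty union, so [partial_selection] cannot ask for (0, 0); maximality
   supplies it. *)
have G0 : G (0, 0).
  apply: (max (fun p => G p \/ p = (0, 0))) => [|p Gp|]; [|by left|by right].
  split.
  - by move=> u v [/(psel_sub pG)//|[-> ->]].
  - move=> u v u' v' [h|[-> ->]] [h'|[-> ->]]; rewrite ?add0r ?addr0;
      try by left.
      by left; apply: (psel_add pG).
    by right.
  - move=> s u v [h|[-> ->]]; first by left; apply: (psel_scale pG).
    by right; rewrite !scaler0.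
  - by move=> v [/(psel_fun pG)//|[->]].
move=> u v Ruv; apply: contrapT => nGu.
have [l [E [E1 Emin]]] := hS.
have [j nGj] : exists j, ~ exists v', G ((E j : S^c) *: u, v').
  apply: contrapT => nj; apply: nGu.
  have : forall j, exists v', G ((E j : S^c) *: u, v').
    by move=> j; apply: contrapT => njj; apply: nj; exists j.
  move=> /choice [w wP]; exists (\sum_j w j).
  rewrite -[u]scale1r -[1 : S^c]/(1 : S) -E1 scaler_suml.
  apply: (big_ind2 (fun x y => G (x, y))) => // *; exact: psel_add.
pose u1 := (E j : S^c) *: u; pose v1 := (E j : S^c) *: v.
have Ruv1 : R u1 v1 by apply: RZ.
pose G' p := exists x y (s : S^c), G (x, y) /\ p = (x + s *: u1, y + s *: v1).
apply: (nGj); exists v1; apply: (max G').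
- split.
  + move=> _ _ [x [y [s [Gxy [-> ->]]]]]; apply: RD; first exact: (psel_sub pG).
    exact: RZ.
  + move=> _ _ _ _ [x [y [s [Gxy [-> ->]]]]] [x' [y' [s' [Gxy' [-> ->]]]]].
    exists (x + x'), (y + y'), (s + s'); split; first exact: (psel_add pG).
    by rewrite !scalerDl addrACA [y + _ + _]addrACA.
  + move=> t _ _ [x [y [s [Gxy [-> ->]]]]].
    exists (t *: x), (t *: y), (t * s); split; first exact: (psel_scale pG).
    by rewrite !scalerDr !scalerA.
  + move=> _ [x [y [s [Gxy [x0 ->]]]]].
    (* Either [s] kills both [u1] and [v1], or multiplying by [t] recovers [u1] from [s *: u1] and
       puts it into the domain of [G]. *)
    have [Es|[t Et]] := Emin j (s : S).
      have s1 (W : lmodType S^c) (w : W) : s *: ((E j : S^c) *: w) = 0.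
        by rewrite scalerA -[s * _]/((E j : S) * s) Es scale0r.
      move: x0; rewrite /u1 /v1 !s1 !addr0 => x0.
      by rewrite -x0 in Gxy; apply: (psel_fun pG).
    case: nGj; exists (- ((t : S^c) *: y)).
    have -> : (E j : S^c) *: u = - ((t : S^c) *: x).
      rewrite (_ : x = - (s *: u1)); last first.
        by apply/eqP; rewrite -addr_eq0 -x0.
      rewrite scalerN opprK /u1 !scalerA; congr (_ *: _).
      by rewrite -[LHS]Et.
    by rewrite -!scaleN1r; do 2! apply: (psel_scale pG).
- by move=> [x y] Gxy; exists x, y, 0; rewrite !scale0r !addr0.
- by exists 0, 0, 1; rewrite !scale1r !add0r.
Qed.

(** Stated for a relation so that a map can be split over its image, within one degree, without
    forming submodules. Linearity of [s] is claimed only on the domain of [R]. *)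
Lemma linear_selection : exists s : U -> V,
  [/\ forall u v, R u v -> R u (s u),
      forall u v u' v', R u v -> R u' v' -> s (u + u') = s u + s u' &
      forall t u v, R u v -> s (t *: u) = t *: s u].
Proof.
have [G pG Gex] := selection_relation.
have /choice [s sP] : forall u, exists w, forall v, R u v -> G (u, w).
  move=> u; have [[v Ruv]|nR] := pselect (exists v, R u v).
    by have [w Gw] := Gex _ _ Ruv; exists w.
  by exists 0 => v Ruv; case: nR; exists v.
have Guniq u v v' : G (u, v) -> G (u, v') -> v = v'.
  move=> h h'; apply/eqP; rewrite -subr_eq0; apply/eqP/(psel_fun pG).
  by rewrite -(subrr u) -!scaleN1r; apply: (psel_add pG) h (psel_scale pG _ h').
exists s; split.
- by move=> u v /sP /(psel_sub pG).
- move=> u v u' v' Ruv Ruv'; apply: (@Guniq (u + u')).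
    exact: sP (RD Ruv Ruv').
  by apply: (psel_add pG); [apply: sP Ruv|apply: sP Ruv'].
- move=> t u v Ruv; apply: (@Guniq (t *: u)); first exact: sP (RZ t Ruv).
  by apply: (psel_scale pG); apply: sP Ruv.
Qed.
End Selection.

(** * Contraction of an acyclic complex and of the cone *)

(* Splitting d : K^i -> im d by a linear selection s makes
   x |-> s (x - s (d x)) a contraction. *)
Section Contraction.
Variable S : pzRingType.
Hypothesis hS : sum_minimal S.
Variables (K : lmodType S^c) (deg : int -> K -> Prop) (d : K -> K).
Hypothesis deg0 : forall i, deg i 0.
Hypothesis degD : forall i y z, deg i y -> deg i z -> deg i (y + z).
Hypothesis degZ : forall i s z, deg i z -> deg i (s *: z).
Hypothesis dD : forall y z, d (y + z) = d y + d z.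
Hypothesis dZ : forall s z, d (s *: z) = s *: d z.
Hypothesis dd : forall z, d (d z) = 0.
Hypothesis acyclic : forall i z, deg i z -> d z = 0 ->
  exists2 w, deg (i - 1) w & d w = z.

Lemma contraction : exists h : int -> K -> K, forall i,
  [/\ forall y z, deg i y -> deg i z -> h i (y + z) = h i y + h i z,
      forall s z, deg i z -> h i (s *: z) = s *: h i z,
      forall z, deg i z -> deg (i - 1) (h i z) &
      forall z, deg i z -> d (h i z) + h (i + 1) (d z) = z].
Proof.
have d0 : d 0 = 0 by rewrite -(scale0r (0 : K)) dZ !scale0r.
have dN z : d (- z) = - d z by rewrite -!scaleN1r dZ.
pose R i z w := deg i w /\ d w = z.
have /choice [s sP] : forall i, exists s : K -> K,
  [/\ forall u v, R i u v -> R i u (s u),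
      forall u v u' v', R i u v -> R i u' v' -> s (u + u') = s u + s u' &
      forall t u v, R i u v -> s (t *: u) = t *: s u].
  move=> i; apply: (linear_selection hS) =>
    [|u v u' v' [hv <-] [hv' <-]|t u v [hv <-]].
  - by [].
  - by split; [apply: degD|rewrite dD].
  - by split; [apply: degZ|rewrite dZ].
have Rd i z : deg i z -> R i (d z) z by [].
have degB i y z : deg i y -> deg i z -> deg i (y - z).
  by move=> hy hz; rewrite -scaleN1r; apply: degD => //; apply: degZ.
(* This difference is a cycle, hence by acyclicity a boundary, hence in the domain where [s (i - 1)]
   is linear. *)
have Ry i z : deg i z -> exists w, R (i - 1) (z - s i (d z)) w.
  move=> hz; have [sR _ _] := sP i; have [hs ds] := sR _ _ (Rd _ _ hz).
  have [||w hw dw] := @acyclic i (z - s i (d z)); first exact: degB.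
    by rewrite dD dN ds subrr.
  by exists w.
exists (fun i z => s (i - 1) (z - s i (d z))) => i.
have [sR sD sZ] := sP i; have [sR' sD' sZ'] := sP (i - 1).
split.
- move=> y z hy hz; have [[w1 R1] [w2 R2]] := (Ry _ _ hy, Ry _ _ hz).
  rewrite dD (sD _ _ _ _ (Rd _ _ hy) (Rd _ _ hz)) opprD addrACA.
  exact: sD' R1 R2.
- move=> t z hz; have [w R1] := Ry _ _ hz.
  by rewrite dZ (sZ _ _ _ (Rd _ _ hz)) -scalerBr (sZ' _ _ _ R1).
- by move=> z hz; have [w /sR' []] := Ry _ _ hz.
- move=> z hz; have [w /sR' [_ ->]] := Ry _ _ hz.
  have [_ _ sZ1] := sP (i + 1).
  have s0 : s (i + 1) 0 = 0.
    by have := sZ1 0 0 0 (conj (deg0 _) d0); rewrite !scale0r.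
  by rewrite dd s0 subr0 addrK subrK.
Qed.
End Contraction.

Section ConeContraction.
Variables (k : fieldType) (S : pzRingType) (eta : {rmorphism k -> S}).
Hypothesis hS : sum_minimal S.
Variables (A : gradedBimodType eta) (b : A -> seq A -> A).
Variables (M N : gradedRModType S).
Variables (m : M -> seq A -> M) (n : N -> seq A -> N) (f : M -> seq A -> N).
Hypotheses (bm : bmod b m) (bn : bmod b n).
Hypotheses (mf : mlin f) (df : fdeg 0 f) (cf : diff b m n false f = 0).

Hypothesis f_inj : forall i x z, homog i x -> m x [::] = 0 ->
  homog (i - 1) z -> f x [::] = n z [::] ->
  exists2 y, homog (i - 1) y & x = m y [::].
Hypothesis f_surj : forall i z, homog i z -> n z [::] = 0 ->
  exists x w, [/\ homog i x, m x [::] = 0, homog (i - 1) w &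
    f x [::] - z = n w [::]].

Let K : lmodType S^c := (M * N)%type.

Let deg i (z : K) : Prop := homog (i + 1) z.1 /\ homog i z.2.

Let mm := bmod_mlin bm.
Let mn := bmod_mlin bn.

Let m_deg i x : homog i x -> homog (i + 1) (m x [::]).
Proof. by move=> hx; rewrite -[i]addr0; apply: (bmod_deg bm). Qed.

Let n_deg i x : homog i x -> homog (i + 1) (n x [::]).
Proof. by move=> hx; rewrite -[i]addr0; apply: (bmod_deg bn). Qed.

Let f_deg i x : homog i x -> homog i (f x [::]).
Proof. by move=> hx; rewrite -[i]addr0 -[i + 0]addr0; apply: df. Qed.

Let m_m x : m (m x [::]) [::] = 0.
Proof.
have := congr1 (fun F => F x [::]) (bmod_eq bm).
by rewrite homDE /bcomp /ins /= !addr0.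
Qed.

Let n_n x : n (n x [::]) [::] = 0.
Proof.
have := congr1 (fun F => F x [::]) (bmod_eq bn).
by rewrite homDE /bcomp /ins /= !addr0.
Qed.

Let f_m x : f (m x [::]) [::] = n (f x [::]) [::].
Proof.
have := congr1 (fun F => F x [::]) cf.
rewrite /diff /= homDE homNE homDE /bcomp /ins /= !addr0 => /eqP.
by rewrite subr_eq0 => /eqP.
Qed.

(** Bijectivity of f_1 on cohomology makes the cone acyclic, so [contraction] applies in each
    degree. The resulting maps are glued on [M] and on [N] separately, as [graded_extension] applies
    to each summand. *)
Lemma cone_contraction : exists h : M * N -> M * N,
  [/\ {morph h : y z / y + z},
      forall (s : S^c) (z : K), h (s *: z) = s *: (h z : K),
      forall i x y, homog (i + 1) x -> homog i y ->
        homog i (h (x, y)).1 /\ homog (i - 1) (h (x, y)).2 &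
      forall z, cone_d m n f (h z) + h (cone_d m n f z) = z].
Proof.
pose d : K -> K := cone_d m n f.
have dD y z : d (y + z) = d y + d z.
  rewrite /d /cone_d /= (mlinDl mm) (mlinDl mf) (mlinDl mn) opprD; congr (_, _).
  exact: addrACA.
have dZ s z : d (s *: z) = s *: d z.
  rewrite /d /cone_d /= (mlinZ0 mm) (mlinZ0 mf) (mlinZ0 mn) -scalerN -scalerDr.
  by [].
have deg0 i : deg i 0 by split; apply: homog0.
have degD i y z : deg i y -> deg i z -> deg i (y + z).
  by move=> [h1 h2] [h3 h4]; split; apply: homogD.
have degZ i s z : deg i z -> deg i (s *: z).
  by move=> [h1 h2]; split; apply: homogZ.
have d_deg i z : deg i z -> deg (i + 1) (d z).
  move=> [h1 h2]; split; first exact/homogN/m_deg.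
  by apply: homogD; [apply: f_deg|apply: n_deg].
have dd z : d (d z) = 0.
  rewrite /d /cone_d /= (mlinNl mm) (mlinNl mf) (mlinDl mn) !m_m n_n f_m.
  by rewrite !oppr0 addr0 addNr.
have acyclic i z : deg i z -> d z = 0 -> exists2 w, deg (i - 1) w & d w = z.
  case: z => x y [/= hx hy] [/eqP]; rewrite oppr_eq0 => /eqP mx0 /eqP fxy.
  have fx : f x [::] = n (- y) [::].
    by apply/eqP; rewrite (mlinNl mn) -addr_eq0.
  have [|z' hz' xz'] := f_inj hx mx0 _ fx; first by rewrite addrK; apply:
    homogN.
  rewrite addrK in hz'.
  (* [x] is the differential of [z'], and [f z' + y] is then a cycle of [N]. A cocycle [x']
     representing it up to the boundary of [w] corrects [z']. *)
  have [||x' [w [hx' mx' hw fx']]] := @f_surj i (f z' [::] + y).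
  - by apply: homogD => //; apply: f_deg.
  - by rewrite (mlinDl mn) -f_m -xz'; apply/eqP.
  exists (x' - z', - w); first by split; rewrite /= ?subrK; [apply:
    homogB|apply: homogN].
  rewrite /d /cone_d /= (mlinDl mm) (mlinNl mm) (mlinDl mf) (mlinNl mf).
  rewrite (mlinNl mn) mx' -xz' add0r opprK -fx'; congr (_, _).
  by rewrite opprB !addrA subrK addrAC subrr add0r.
have [h hP] := contraction hS deg0 degD degZ dD dZ dd acyclic.
have Dl x y : ((x + y, 0) : K) = (x, 0) + (y, 0).
  by transitivity ((x + y, 0 + 0) : K); first by rewrite addr0.
have Dr x y : ((0, x + y) : K) = (0, x) + (0, y).
  by transitivity ((0 + 0, x + y) : K); first by rewrite addr0.
have Zl s x : ((s *: x, 0) : K) = s *: ((x, 0) : K).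
  by transitivity ((s *: x, s *: 0) : K); first by rewrite scaler0.
have Zr s x : ((0, s *: x) : K) = s *: ((0, x) : K).
  by transitivity ((s *: 0, s *: x) : K); first by rewrite scaler0.
(* [M] is shifted in the cone: its degree [i] part has cone degree [i - 1]. *)
have degx i x : homog i x -> deg (i - 1) (x, 0).
  by move=> hx; split; rewrite /= ?subrK //; apply: homog0.
have degy i y : homog i y -> deg i (0, y) by split=> //; apply: homog0.
have [hx [hxD hxZ hxE]] : exists hx : M -> K, [/\ {morph hx : x y / x + y},
    forall s x, hx (s *: x) = s *: hx x &
    forall i x, homog i x -> hx x = h (i - 1) (x, 0)].
  apply: (graded_extension (phi := fun i x => h (i - 1) (x, 0) : K)).
    move=> i x y /degx h1 /degx h2; have [hD _ _ _] := hP (i - 1).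
    by rewrite ?Dl ?Dr hD.
  move=> i s x /degx h1; have [_ hZ _ _] := hP (i - 1).
  by rewrite ?Zl ?Zr hZ.
have [hy [hyD hyZ hyE]] : exists hy : N -> K, [/\ {morph hy : x y / x + y},
    forall s x, hy (s *: x) = s *: hy x &
    forall i x, homog i x -> hy x = h i (0, x)].
  apply: (graded_extension (phi := fun i x => h i (0, x) : K)).
    move=> i x y /degy h1 /degy h2; have [hD _ _ _] := hP i.
    by rewrite ?Dl ?Dr hD.
  move=> i s x /degy h1; have [_ hZ _ _] := hP i.
  by rewrite ?Zl ?Zr hZ.
pose g (z : K) : K := hx z.1 + hy z.2.
have gD : {morph g : y z / y + z}.
  by move=> y z; rewrite /g hxD hyD addrACA.
have gE i z : deg i z -> g z = h i z.
  move=> [hz1 hz2]; have [hD _ _ _] := hP i.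
  rewrite /g (hxE _ _ hz1) (hyE _ _ hz2) addrK -hD; last exact: degy.
    by congr (h i _); case: (z) => x y; congr (_, _); rewrite /= ?addr0 ?add0r.
  by rewrite -[i](addrK 1); apply: degx.
exists g; split=> //.
- by move=> s z; rewrite /g hxZ hyZ -scalerDr.
- move=> i x y hx' hy'; have [_ _ hdeg _] := hP i.
  have dz : deg i (x, y) by [].
  by have [h1 h2] := hdeg _ dz; rewrite (gE i) //; move: h1; rewrite subrK.
- move=> z; rewrite -/d.
  pose C z := d (g z) + g (d z) = z.
  have CD y y' : C y -> C y' -> C (y + y').
    by rewrite /C (gD y) (dD y) (dD (g y)) (gD (d y)) addrACA => -> ->.
  have Cdeg i y : deg i y -> C y.
    move=> hy'; rewrite /C (gE i) // (gE (i + 1)); last exact: d_deg.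
    by have [_ _ _] := hP i; apply.
  have C1 x : C (x, 0).
    elim/homog_ind: x => [|x y h1 h2|i x /degx]; [exact: (Cdeg 0)| |exact:
      Cdeg].
    by rewrite ?Dl ?Dr; apply: CD.
  have C2 x : C (0, x).
    elim/homog_ind: x => [|x y h1 h2|i x /degy]; [exact: (Cdeg 0)| |exact:
      Cdeg].
    by rewrite ?Dl ?Dr; apply: CD.
  have := CD _ _ (C1 z.1) (C2 z.2); rewrite [X in C X](_ : _ = z) //.
  by case: (z) => x y; transitivity ((x + 0, 0 + y) : K);
    last rewrite addr0 add0r.
Qed.
End ConeContraction.

(** * Maps on tensor powers as multilinear families *)

Section Values.
Variables (k : fieldType) (S : pzRingType) (eta : {rmorphism k -> S}).
Variable A : bimodType eta.

Definition shift (M N : lmodType S^c) (f : tfamily A M N) :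
  tfamily A (tensor M A) N := fun n => f n.+1.

Section Value.
Variable N : lmodType S^c.

Lemma value_cons (M : lmodType S^c) (f : tfamily A M N) x u a :
  value f x (u :: a) = value (shift f) (tens x u) a.
Proof. by []. Qed.

Lemma valueDl (M : lmodType S^c) (f : tfamily A M N) x y a :
  value f (x + y) a = value f x a + value f y a.
Proof.
elim: a M f x y => [|u a IH] M f x y; first exact: (raddfD (f 0%N)).
by rewrite !value_cons; have [-> _ _] := tens_balanced M A; exact:
  (IH _ (shift f)).
Qed.

Lemma mlin_value (M : lmodType S^c) (f : tfamily A M N) : mlin (value f).
Proof.
have B0 (L : lmodType S^c) (g : tfamily A L N) x (s : S) v q :
    value g ((s : S^c) *: x) (v :: q) = value g x (lact s v :: q).
  by rewrite !value_cons; have [_ _ ->] := tens_balanced L A.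
split.
- exact: valueDl.
- move=> x p; elim: p M f x => [|w p IH] M f x u v q /=; last exact:
    (IH _ (shift f) (tens x w)).
  rewrite !value_cons; have [_ -> _] := tens_balanced M A.
  exact: valueDl.
- exact: B0.
- move=> x p; elim: p M f x => [|w p IH] M f x u s v q /=; last exact:
    (IH _ (shift f) (tens x w)).
  by rewrite value_cons -scale_tens B0.
- by move=> x s; rewrite /value linearZ.
- move=> x p; elim: p M f x => [|w p IH] M f x u s /=; last exact:
    (IH _ (shift f) (tens x w)).
  by rewrite value_cons -scale_tens /value linearZ.
Qed.
End Value.

Section Lift.
Variable N : lmodType S^c.

Definition curry_tensor (M : lmodType S^c) (F : M -> seq A -> N)
    (u : tensor M A) (a : seq A) : N :=
  tensor_lift (fun x v => F x (v :: a)) u.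

Fixpoint lift (n : nat) (M : lmodType S^c) (F : M -> seq A -> N) :
    tpow A n M -> N :=
  if n is n'.+1 return tpow A n M -> N then @lift n' _ (curry_tensor F)
  else fun x => F x [::].

Lemma curry_tensor_bal (M : lmodType S^c) (F : M -> seq A -> N) a :
  mlin F -> balanced (fun x v => F x (v :: a)).
Proof.
move=> mF; split=> *; first exact: mlinDl.
  exact: (mlinDr mF _ [::]).
exact: mlinB0.
Qed.

Lemma mlin_curry (M : lmodType S^c) (F : M -> seq A -> N) :
  mlin F -> mlin (curry_tensor F).
Proof.
move=> mF; have bF a := curry_tensor_bal a mF.
have cB a u v : curry_tensor F (u - v) a = curry_tensor F u a - curry_tensor F
  v a.
  exact: tensor_liftB.
have cE x v a : curry_tensor F (tens x v) a = F x (v :: a) by apply: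
  tensor_liftE.
split.
- move=> x y a; have c0 : curry_tensor F 0 a = 0 by rewrite -(subrr 0) cB subrr.
  by rewrite -{1}[y]opprK -[- y]sub0r !cB c0 sub0r opprK.
- move=> x p u v q; elim/tensor_ind: x => [x y hx hy|x w].
    by rewrite !cB hx hy opprD addrACA.
  by rewrite !cE -!cat_cons (mlinDr mF).
- move=> x s v q; elim/tensor_ind: x => [x y hx hy|x w].
    by rewrite scalerBr !cB hx hy.
  by rewrite scale_tens !cE (mlinB mF _ [::]).
- move=> x p u s v q; elim/tensor_ind: x => [x y hx hy|x w].
    by rewrite !cB hx hy.
  by rewrite !cE -!cat_cons (mlinB mF).
- move=> x s; elim/tensor_ind: x => [x y hx hy|x w].
    by rewrite scalerBr !cB hx hy scalerBr.
  by rewrite scale_tens !cE (mlinZ mF _ [::]).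
- move=> x p u s; elim/tensor_ind: x => [x y hx hy|x w].
    by rewrite !cB hx hy scalerBr.
  by rewrite !cE -!cat_cons (mlinZ mF).
Qed.

Lemma lift_linear n (M : lmodType S^c) (F : M -> seq A -> N) :
  mlin F -> linear (@lift n M F).
Proof.
elim: n M F => [|n IH] M F mF; last exact: IH (mlin_curry mF).
by move=> s x y; rewrite /= (mlinDl mF) (mlinZ0 mF).
Qed.

Lemma lift_pure (M : lmodType S^c) (F : M -> seq A -> N) x a :
  mlin F -> lift F (pure x a) = F x a.
Proof.
elim: a M F x => [|u a IH] M F x mF //=.
rewrite IH; last exact: mlin_curry.
exact: (tensor_liftE (curry_tensor_bal a mF) x u).
Qed.

(** The universal property of the iterated tensor product, converse to [mlin_value]. [lift] factors
    the letters through tensor products in the order in which [tpow] absorbs them into the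
    module. *)
Lemma value_surj (M : lmodType S^c) (F : M -> seq A -> N) : mlin F ->
  exists f : tfamily A M N, value f = F.
Proof.
move=> mF.
exists (fun n => HB.pack_for {linear tpow A n M -> N} (@lift n M F)
  (GRing.isLinear.Build S^c _ _ _ _ (lift_linear (n := n) mF))).
apply/funext => x; apply/funext => a; exact: lift_pure.
Qed.
End Lift.
End Values.

(** * Suspension signs *)

Section Twist.
Variables (k : fieldType) (S : pzRingType) (eta : {rmorphism k -> S}).
Variable A : gradedBimodType eta.

(** Every letter is signed by the number of letters after it; [j] counts those that follow the word
    itself, as needed for [twk_cat]. *)
Fixpoint twk (j : nat) (a : seq A) : seq A :=
  if a is u :: a' then taun (size a' + j) u :: twk j a' else [::].

Lemma size_twk j a : size (twk j a) = size a.
Proof. by elim: a => //= u a ->. Qed.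

Lemma twk_cat j p q : twk j (p ++ q) = twk (size q + j) p ++ twk j q.
Proof. by elim: p => //= u p ->; rewrite size_cat addnA. Qed.

Lemma twkK j : involutive (twk j).
Proof. by elim=> //= u a ->; rewrite size_twk taunK. Qed.

(* The values of the family on the suspended modules: the signs (-1)^(n-j)|a_j|
   arise from moving the n suspensions past x (x) a_1 (x) ... (x) a_n. *)
Definition twist (M : gradedRModType S) (V : Type) (F : M -> seq A -> V) x a :=
  F (taun (size a) x) (twk 0 a).

Lemma twistK (M : gradedRModType S) (V : Type) : involutive (@twist M V).
Proof.
move=> F; apply/funext => x; apply/funext => a.
by rewrite /twist size_twk taunK twkK.
Qed.

Lemma mlin_twist (M : gradedRModType S) (N : lmodType S^c) (F :
  M -> seq A -> N) :
  mlin F -> mlin (twist F).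
Proof.
move=> mF; split=> [x y a|x p u v q|x s v q|x p u s v q|x s|x p u s];
  rewrite /twist ?size_cat ?twk_cat /=.
- by rewrite taunD (mlinDl mF).
- by rewrite taunD (mlinDr mF).
- by rewrite taunZ (mlinB0 mF) taun_lact.
- by rewrite taunZ (mlinB mF) taun_lact.
- exact: mlinZ0.
- by rewrite taunZ (mlinZ mF).
Qed.

Lemma hword_twk n j a : hword n a -> hword n (twk j a).
Proof.
elim: a n => [|u a IH] n //= [i hu /IH ha].
by exists i => //; apply: homog_taun.
Qed.

Lemma hwordE n (a : seq A) :
  hword n a <-> exists2 d, homogs d a & n = \sum_(j <- d) j - (size a)%:Z.
Proof.
elim: a n => [|u a IH] n /=.
  split=> [->|[[|//] _ ->]]; last by rewrite big_nil.
  by exists [::]; rewrite ?big_nil.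
split=> [[i hu /IH [d hd nd]]|[[|i d] //= [hu hd] ->]].
  exists (i :: d) => //; rewrite big_cons; move: nd; move: (\sum_(j <- d) j) =>
    t; lia.
exists i => //; apply/IH; exists d => //; rewrite big_cons; move:
  (\sum_(j <- d) j) => t; lia.
Qed.

Lemma fdeg_twist (M N : gradedRModType S) e (F : M -> seq A -> N) :
  fdeg e F -> fdeg e (twist F).
Proof.
by move=> dF i n x a hx ha; apply: dF; [apply: homog_taun|apply: hword_twk].
Qed.

Lemma fdeg_value (M N : gradedRModType S) (e : int) (f : tfamily A M N) :
  tfamily_degree f (fun n => e + 1 - n%:Z) <-> fdeg e (value f).
Proof.
split=> [df i n x a hx /hwordE [d hd ->]|df n p u].
  rewrite (_ : _ + e = i + \sum_(j <- d) j + (e + 1 - (size a).+1%:Z));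
    last lia.
  by apply: df; apply: TpowHomogPure.
elim=> {n p u} [n p|n p u v _ hu _ hv|i x d a hx hd].
- by rewrite raddf0; apply: homog0.
- by rewrite raddfD; apply: homogD.
- have := df i _ x a hx (proj2 (hwordE _ _) (ex_intro2 _ _ d hd erefl)).
  by congr (homog _ _); rewrite -addn1 PoszD; ring.
Qed.
End Twist.

Lemma parM m n : par (m * n) = par m && par n.
Proof. by rewrite /par abszM oddM. Qed.

Section Letters.
Variables (k : fieldType) (S : pzRingType) (eta : {rmorphism k -> S}).
Variable A : gradedBimodType eta.
Implicit Types (w p q r : seq (int * A)).

(* A word of homogeneous letters, each paired with its degree. *)
Fixpoint hlet w : Prop :=
  if w is (d, u) :: w' then homog d u /\ hlet w' else True.

Definition dsum w : int := \sum_(j <- unzip1 w) j.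

Lemma dsum_cons l w : dsum (l :: w) = l.1 + dsum w.
Proof. by rewrite /dsum /= big_cons. Qed.

Lemma homogs_hlet d (a : seq A) :
  homogs d a -> exists w, [/\ hlet w, unzip1 w = d & unzip2 w = a].
Proof.
elim: a d => [|u a IH] [|i d] //=; first by exists [::].
by move=> [hu /IH [w [hw <- <-]]]; exists ((i, u) :: w).
Qed.

Lemma hlet_cat p q : hlet (p ++ q) <-> hlet p /\ hlet q.
Proof.
by elim: p => [|[d u] p IH] /=; [split=> [|[]]|rewrite IH;
  split=> [[? []]|[[]]]].
Qed.

Lemma hlet_hword w : hlet w -> hword (dsum w - (size w)%:Z) (unzip2 w).
Proof.
elim: w => [|[d u] w IH] /=; first by rewrite /dsum big_nil subr0.
move=> [hu /IH hw]; exists d => //; rewrite dsum_cons /=.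
by rewrite (_ : _ - _ - _ = dsum w - (size w)%:Z) // -addn1 PoszD; ring.
Qed.

Fixpoint tws (j : nat) w : bool :=
  if w is l :: w' then (odd (size w' + j) && par l.1) (+) tws j w' else false.

Lemma tws_cat j p q : tws j (p ++ q) = tws (size q + j) p (+) tws j q.
Proof. by elim: p => //= l p ->; rewrite size_cat addnA addbA. Qed.

(** Each of the [j] letters behind the word contributes the total degree of the word once. *)
Lemma tws_shift j w : tws j w = (odd j && par (dsum w)) (+) tws 0 w.
Proof.
elim: w => [|l w IH] /=; first by rewrite /dsum big_nil /= andbF.
rewrite IH dsum_cons parD addn0 oddD.
by case: (odd j); case: (odd (size w)); case: (par l.1); case: (par (dsum w));
  case: (tws 0 w).
Qed.

Definition twsign i w : bool := (odd (size w) && par i) (+) tws 0 w.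

Section Signs.
Variables (M : gradedRModType S) (N : lmodType S^c) (F : M -> seq A -> N).
Hypothesis mF : mlin F.

Lemma twk_sign j w x c : hlet w ->
  F x (c ++ twk j (unzip2 w)) = sg (tws j w) (F x (c ++ unzip2 w)).
Proof.
elim: w c => [|[d u] w IH] c //= [hu hw].
rewrite size_map (taun_homog _ hu) (mlin_sgr mF) -cat_rcons IH // cat_rcons.
by rewrite -sg_addb.
Qed.

Lemma twistE i w x : homog i x -> hlet w ->
  twist F x (unzip2 w) = sg (twsign i w) (F x (unzip2 w)).
Proof.
move=> hx hw; rewrite /twist size_map (taun_homog _ hx) (mlin_sgl mF).
by rewrite (twk_sign 0 x [::] hw) -sg_addb.
Qed.

Lemma sig_sign w x c a : hlet w ->
  F x (c ++ map sig (unzip2 w) ++ a)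
  = sg (par (dsum w) (+) odd (size w)) (F x (c ++ unzip2 w ++ a)).
Proof.
elim: w c => [|[d u] w IH] c /=; first by rewrite /dsum big_nil.
move=> [hu hw]; rewrite (sig_homog hu) (mlin_sgr mF) -cat_rcons IH // cat_rcons.
rewrite -sg_addb dsum_cons parD; congr (sg _ _).
by case: (par d); case: (par (dsum w)); case: odd.
Qed.
End Signs.

End Letters.

Section Transfer.
Variables (k : fieldType) (S : pzRingType) (eta : {rmorphism k -> S}).

Lemma comp_sum_spl (A : ainfAlgebra eta) (M N P : gradedRModType S)
  (e : nat -> nat -> nat) (g : tfamily A N P) (f : tfamily A M N) x a :
  comp_sum e g f x a = spl (fun p q =>
    sg (odd (e (size p).+1 (size q))) (value g (value f x p) q)) a.
Proof.
rewrite /comp_sum splE big_add1 /=; apply: eq_big_nat => r /andP[_ ra].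
by rewrite mulrz_sgn par_nat size_takel // size_drop subSS.
Qed.

(** The exponent required is (e' + r + 1)s modulo 2. For e' = 0 this is the sign (r + 1)s of
    morphisms, for e' = -1 the sign rs of homotopies, and for e' = 1 the sign of the outer sum. *)
Lemma transfer_comp (A : ainfAlgebra eta) (M N P : gradedRModType S) (e' : int)
  (e : nat -> nat -> nat) (g : tfamily A N P) (f : tfamily A M N) i x
  (w : seq (int * A)) :
  fdeg e' (value f) ->
  (forall r s, odd (e r s) = odd s && (par e' (+) ~~ odd r)) ->
  homog i x -> hlet w ->
  comp_sum e g f x (unzip2 w)
  = sg (twsign i w) (bcomp (twist (value g)) (twist (value f)) x (unzip2 w)).
Proof.
move=> df he hx hw; have [mf mg] := (mlin_value f, mlin_value g).
rewrite comp_sum_spl /bcomp !spl_map.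
rewrite (spl_sum (h := sg (twsign i w))) ?sg0 //; last exact: sgD.
apply: eq_spl => p q pq; move: (hw); rewrite -pq => /hlet_cat [hp hq].
rewrite (twistE mf hx hp) (mlin_sgl (mlin_twist mg)).
rewrite (twistE mg (df _ _ _ _ hx (hlet_hword hp)) hq) -!sg_addb;
  congr (sg _ _).
rewrite he /twsign tws_cat addn0 (tws_shift (size q) p) !size_map size_cat oddD.
rewrite !parD parN par_nat /=.
case: (odd (size p)); case: (odd (size q)); case: (par i); case: (par e');
by case: (par (dsum p)); case: (tws 0 p); case: (tws 0 q).
Qed.

Lemma inner_sum_pts (A : ainfAlgebra eta) (M N : gradedRModType S)
  (f : tfamily A M N) i x (w : seq (int * A)) :
  inner_sum f i (unzip1 w) x (unzip2 w) = pts (fun p u => spl (fun q r =>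
    sg (odd ((size p).+1 + (size q).+1 * size r)
        (+) (odd (size q).+1 && (par i (+) par (dsum p))))
      (value f x (unzip2 p ++ value (@alg_m _ _ _ A) u.2 (unzip2 q) ::
        unzip2 r)))) w.
Proof.
(* The index [r] counts [x] as well, so [p] has r - 1 letters; the first letter of the block is
   split off, so [q] has s - 1. The default of [nth] is never reached. *)
rewrite /inner_sum size_map big_add1 /= (ptsE (0, 0)).
apply: eq_big_nat => r /andP[_ rw]; rewrite splE big_add1 /=.
rewrite size_drop (_ : (size w).+1 - r.+1 = (size w - r.+1).+1)%N; last lia.
apply: eq_big_nat => s /andP[_ sw].
rewrite mulrz_sgn parD par_nat parM !parD parN; congr (sg (_ (+) _) _).
- rewrite !size_takel ?size_drop; [|lia|lia].
  by rewrite subSS.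
- rewrite size_takel ?size_drop; last lia.
  by rewrite /dsum /unzip1 map_take.
- rewrite /unzip2 -!map_drop -!map_take (drop_nth (0, 0) rw) /=.
  by rewrite drop_drop !addnS addnC.
Qed.

(** The twists of the block, of the shortened word and of the whole word, together with [sig] on the
    letters passed, multiply to (-1)^(r+st) times the Koszul sign. *)
Lemma transfer_inner (A : ainfAlgebra eta) (M N : gradedRModType S)
  (f : tfamily A M N) i x (w : seq (int * A)) :
  fdeg 1 (value (@alg_m _ _ _ A)) -> homog i x -> hlet w ->
  inner_sum f i (unzip1 w) x (unzip2 w)
  = sg (twsign i w)
      (ins (twist (value (@alg_m _ _ _ A))) (twist (value f)) x (unzip2 w)).
Proof.
move=> dm hx hw; have mf := mlin_value f;
  have mm := mlin_value (@alg_m _ _ _ A).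
rewrite inner_sum_pts /ins pts_map (pts_sum (h := sg (twsign i w))) ?sg0 //;
  last exact: sgD.
apply: eq_pts => p [du u] y py; rewrite spl_map.
rewrite (spl_sum (h := sg (twsign i w))) ?sg0 //; last exact: sgD.
apply: eq_spl => q r qr.
move: (hw); rewrite -py -qr => /hlet_cat [hp [hu /hlet_cat [hq hr]]].
have mtf := mlin_twist mf.
rewrite (sig_homog hx) (mlin_sgl mtf) (sig_sign mtf _ [::] _ hp) cat0s.
rewrite (twistE mm hu hq) (mlin_sgr mtf).
have hz := dm _ _ _ _ hu (hlet_hword hq).
(* The inserted letter carries the degree of m_s on the block, which makes [twistE] applicable to
   the shortened word. *)
have hl : hlet (p ++ (du + (dsum q - (size q)%:Z) + 1,
    value (@alg_m _ _ _ A) u (unzip2 q)) :: r) by apply/hlet_cat.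
have := twistE mf hx hl; rewrite /unzip2 map_cat /= => ->; rewrite -!sg_addb;
  congr (sg _ _).
rewrite /twsign !tws_cat /= tws_cat !addn0.
rewrite (tws_shift (size (q ++ r)).+1 p) (tws_shift (size r).+1 p).
rewrite (tws_shift (size r) q) !size_cat /= !oddD /= oddM /= !parD parN par_nat.
rewrite (_ : par 1 = true) //= !size_cat !oddD.
case: (odd (size p)); case: (odd (size q)); case: (odd (size r)); case: (par i);
case: (par du); case: (par (dsum p)); case: (par (dsum q)); by
case: (tws 0 p); case: (tws 0 q); case: (tws 0 r).
Qed.
End Transfer.

(** * The identity family *)

Section Identity.
Variables (k : fieldType) (S : pzRingType) (eta : {rmorphism k -> S}).
Variables (A : gradedBimodType eta) (b : A -> seq A -> A).

Definition idf (M : lmodType S^c) (x : M) (a : seq A) : M :=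
  if a is [::] then x else 0.

Lemma mlin_idf (M : lmodType S^c) : mlin (@idf M).
Proof.
split=> [x y [|u a]|x [|w p] u v q|x s v q|x [|w p] u s v q|x s|x [|w p] u s]
  //=;
  by rewrite ?addr0 ?scaler0.
Qed.

Lemma fdeg_idf (M : gradedRModType S) : fdeg 0 (@idf M).
Proof.
move=> i n x [|u a] hx /=; first by move->; rewrite !addr0.
by move=> _; apply: homog0.
Qed.

Lemma bcomp_idl (M : Type) (N : lmodType S^c) (F : M -> seq A -> N) :
  bcomp (@idf N) F = F.
Proof.
by apply/funext => x; apply/funext => a; apply: spl_last.
Qed.

Lemma bcomp_idr (M N : lmodType S^c) (F : M -> seq A -> N) :
  mlin F -> bcomp F (@idf M) = F.
Proof.
move=> mF; apply/funext => x; apply/funext => a.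
by apply: spl_first => u p q _; apply: mlin0l.
Qed.

Lemma bcomp0r (L M N : lmodType S^c) (F : M -> seq A -> N) :
  mlin F -> bcomp F (0 : L -> seq A -> M) = 0.
Proof.
move=> mF; apply/funext => x; apply/funext => a.
by rewrite -[RHS](spl0 _ a); apply: eq_spl => p q _; apply: mlin0l.
Qed.

Lemma ins_idf (M : gradedRModType S) : ins b (@idf M) = 0.
Proof.
apply/funext => x; apply/funext => a; rewrite -[RHS](pts0 _ a).
apply: eq_pts => p u y _; rewrite -[RHS](spl0 _ y).
by apply: eq_spl => q r _; case: p.
Qed.

Lemma diff_idf (M : gradedRModType S) (m : M -> seq A -> M) :
  mlin m -> diff b m m false (@idf M) = 0.
Proof.
by move=> mm; rewrite /diff bcomp_idl bcomp_idr // ins_idf addr0 subrr.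
Qed.

Lemma diff0 (M N : gradedRModType S) (m : M -> seq A -> M)
  (n : N -> seq A -> N) c : mlin n -> diff b m n c 0 = 0.
Proof.
move=> mn.
have e : diff b m n c (0 + 0) = diff b m n c 0 + diff b m n c 0.
  by rewrite /diff bcompDl insD (bcompDr mn) [X in sg _ X]addrACA sgD addrACA.
by apply: (addIr (diff b m n c 0)); rewrite -e !add0r.
Qed.
End Identity.

(** * Homotopy inverse in the bar convention *)

Section Homotopy.
Variables (k : fieldType) (S : pzRingType) (eta : {rmorphism k -> S}).
Hypothesis hS : sum_minimal S.
Variables (A : gradedBimodType eta) (b : A -> seq A -> A).
Hypotheses (mb : mlin b) (db : fdeg 1 b) (bb : bcomp b b + ins b b = 0).
Hypothesis b_lact : forall s u q, b (lact s u) q = lact s (b u q).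
Variables (M N : gradedRModType S).
Variables (m : M -> seq A -> M) (n : N -> seq A -> N) (f : M -> seq A -> N).
Hypotheses (bm : bmod b m) (bn : bmod b n).
Hypotheses (mf : mlin f) (df : fdeg 0 f) (cf : diff b m n false f = 0).
Hypothesis f_inj : forall i x z, homog i x -> m x [::] = 0 ->
  homog (i - 1) z -> f x [::] = n z [::] ->
  exists2 y, homog (i - 1) y & x = m y [::].
Hypothesis f_surj : forall i z, homog i z -> n z [::] = 0 ->
  exists x w, [/\ homog i x, m x [::] = 0, homog (i - 1) w &
    f x [::] - z = n w [::]].

Let mm := bmod_mlin bm.
Let mn := bmod_mlin bn.

(* Apply the obstruction lemma to (0, id) : N -> cone(f), then to
   (gf - id, hf) : M -> cone(f). *)
Lemma homotopy_inverse : exists (g : N -> seq A -> M)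
    (h : N -> seq A -> N) (h' : M -> seq A -> M),
  [/\ [/\ mlin g, fdeg 0 g & diff b n m false g = 0],
      [/\ mlin h, fdeg (-1) h & bcomp f g - @idf _ _ _ A N = diff b n n true h]
        &
      [/\ mlin h', fdeg (-1) h' &
          bcomp g f - @idf _ _ _ A M = diff b m m true h']].
Proof.
have [c [cD cZ cdeg c_contr]] := cone_contraction hS bm bn mf df cf f_inj
  f_surj.
have obs := obstruction mb db bb b_lact _ bm bn mf df cf cD cZ cdeg c_contr.
have [g [h [[mg dg] [mh dh] cg Eh]]] :
    exists (G1 : N -> seq A -> M) (G2 : N -> seq A -> N),
      [/\ mlin G1 /\ fdeg 0 G1, mlin G2 /\ fdeg (-1) G2,
          0 = - diff b n m false G1 &
          @idf _ _ _ A N = bcomp f G1 + diff b n n true G2].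
  (* The identity sits in the component of degree e - 1, so the cycle has degree e = 1. *)
  have := @obs N n bn 1 0 (@idf _ _ _ A N) _ _ _ _ _ _; apply.
  - exact: mlin0.
  - exact: fdeg0.
  - exact: mlin_idf.
  - exact: fdeg_idf.
  - exact: diff0.
  - by rewrite bcomp0r // add0r; apply: diff_idf.
have {}cg : diff b n m false g = 0 by apply: oppr_inj; rewrite -cg oppr0.
exists g, (- h).
have [h' [_ [[mh' dh'] _ Eh' _]]] :
    exists (G1 : M -> seq A -> M) (G2 : M -> seq A -> N),
      [/\ mlin G1 /\ fdeg (-1) G1, mlin G2 /\ fdeg (-2) G2,
          bcomp g f - @idf _ _ _ A M = - diff b m m true G1 &
          bcomp h f = bcomp f G1 + diff b m n false G2].
  have := @obs M m bm 0 (bcomp g f - @idf _ _ _ A M) (bcomp h f) _ _ _ _ _ _.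
  apply.
  - by apply: mlinD; [apply: mlin_comp|apply/mlinN/mlin_idf].
  - by apply: fdegD; [rewrite -[0]addr0; apply: fdeg_comp|apply/fdegN/fdeg_idf].
  - exact: mlin_comp.
  - by rewrite -[0 - 1]addr0; apply: fdeg_comp.
  - rewrite (diffD m bm) (diffN m bm) diff_idf // oppr0 addr0.
    by rewrite (diff_compl m bm mg cg mf df) cf bcomp0r.
  (* Here f (gf - id) + (D h) f = (fg + D h) f - f, and fg + D h is the identity of [N]. *)
  - rewrite (bcompDr mf) (bcompNr mf) bcomp_idr // (bcompA mf).
    rewrite (diff_compr bn _ mf df cf mh) addrAC -bcompDl.
    by rewrite -Eh bcomp_idl subrr.
exists (- h'); split; split=> //.
- exact: mlinN.
- exact: fdegN.
- by rewrite (diffN n bn) Eh opprD addrA subrr add0r.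
- exact: mlinN.
- exact: fdegN.
- by rewrite (diffN m bm).
Qed.
End Homotopy.

(** * Translation between the definitions and the bar convention *)

Section Main.
Variables (k : fieldType) (S : pzRingType) (eta : {rmorphism k -> S}).
Variable A : ainfAlgebra eta.

Let b : A -> seq A -> A := twist (value (@alg_m _ _ _ A)).

Lemma eq_degree (M N : gradedRModType S) (f : tfamily A M N) (e e' :
  nat -> int) :
  (forall n, e n = e' n) -> tfamily_degree f e -> tfamily_degree f e'.
Proof. by move=> ee df n p u /df; rewrite ee. Qed.

Lemma value_deg (M N : gradedRModType S) (f : tfamily A M N) (c e : int) :
  c = e + 1 -> tfamily_degree f (fun n => c - n%:Z) <-> fdeg e (value f).
Proof. by move=> ->; apply: fdeg_value. Qed.

Lemma alg_deg : fdeg 1 (value (@alg_m _ _ _ A)).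
Proof. exact/(value_deg _ (erefl (1 + 1)))/alg_m_degree. Qed.

Lemma mlin_b : mlin b.
Proof. exact/mlin_twist/mlin_value. Qed.

Lemma deg_b : fdeg 1 b.
Proof. exact/fdeg_twist/alg_deg. Qed.

Lemma b_lact s u q : b (lact s u) q = lact s (b u q).
Proof. by rewrite /b /twist taun_lact alg_m_lact. Qed.

Lemma outer_comp (M N : gradedRModType S) (f : tfamily A M N)
  (m : tfamily A M M) x a :
  outer_sum f m x a = comp_sum (fun r s => (r * s)%N) f m x a.
Proof. by []. Qed.

Section Word.
Variables (M N : gradedRModType S) (i : int) (x : M) (w : seq (int * A)).
Hypotheses (hx : homog i x) (hw : hlet w).

Lemma transfer_outer (f : tfamily A M N) (m : tfamily A M M) :
  fdeg 1 (value m) -> outer_sum f m x (unzip2 w)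
  = sg (twsign i w) (bcomp (twist (value f)) (twist (value m)) x (unzip2 w)).
Proof.
move=> dm; rewrite outer_comp; apply: transfer_comp dm _ hx hw => r s.
by rewrite oddM /= negbK andbC.
Qed.

Lemma transfer_diff0 (f : tfamily A M N) (m : tfamily A M M)
  (n : tfamily A N N) : fdeg 1 (value m) -> fdeg 0 (value f) ->
  inner_sum f i (unzip1 w) x (unzip2 w) + outer_sum f m x (unzip2 w)
  - comp_sum (fun r s => (r.+1 * s)%N) n f x (unzip2 w)
  = - sg (twsign i w) (diff b (twist (value m)) (twist (value n)) false
                         (twist (value f)) x (unzip2 w)).
Proof.
move=> dm df; rewrite (transfer_inner _ alg_deg) // transfer_outer //.
rewrite (transfer_comp _ df _ hx hw); last by move=> r s; rewrite oddM andbC.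
rewrite -!sgN -!sgD; congr (sg _ _).
rewrite /diff /= homDE homNE homDE opprB; congr (_ - _); exact: addrC.
Qed.

Lemma transfer_diff1 (h : tfamily A M N) (m : tfamily A M M)
  (n : tfamily A N N) : fdeg 1 (value m) -> fdeg (-1) (value h) ->
  comp_sum (fun r s => (r * s)%N) n h x (unzip2 w) + outer_sum h m x (unzip2 w)
    + inner_sum h i (unzip1 w) x (unzip2 w)
  = sg (twsign i w) (diff b (twist (value m)) (twist (value n)) true
                       (twist (value h)) x (unzip2 w)).
Proof.
move=> dm dh; rewrite (transfer_inner _ alg_deg) // transfer_outer //.
rewrite (transfer_comp _ dh _ hx hw); last first.
  by move=> r s; rewrite oddM andbC /par /= negbK.
by rewrite -!sgD /diff /= !homDE addrA.
Qed.
End Word.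

Lemma hword_hlet n (a : seq A) :
  hword n a -> exists2 w : seq (int * A), hlet w & unzip2 w = a.
Proof. by move=> /hwordE [d /homogs_hlet [w [hw _ <-]] _]; exists w. Qed.

(** The equations in the definitions are known on homogeneous elements only; additivity in every
    argument spreads them to all words. *)
Lemma mlin_ext (M : gradedRModType S) (N : lmodType S^c) (F : M -> seq A -> N) :
  mlin F -> (forall i x (w : seq (int * A)),
    homog i x -> hlet w -> F x (unzip2 w) = 0) ->
  F = 0.
Proof.
move=> mF F0; apply/funext => x; apply/funext => a.
apply: (@additive_ext _ _ _ A _ _ F (mlinDl mF) (mlinDr mF)) => i n y c hy.
by move=> /hword_hlet [w hw <-]; apply: F0 hy hw.
Qed.

Lemma twist_bmod (M : gradedRModType S) (m : tfamily A M M) :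
  fdeg 1 (value m) ->
  (forall i d x a, homog i x -> homogs d a ->
     inner_sum m i d x a + outer_sum m m x a = 0) ->
  bcomp (twist (value m)) (twist (value m)) + ins b (twist (value m)) = 0.
Proof.
move=> dm em; have mm := mlin_twist (mlin_value m).
apply: mlin_ext => [|i x w hx hw].
  by apply: mlinD; [apply: mlin_comp|apply: mlin_ins mm; [apply: mlin_b|apply:
    b_lact]].
have hd : homogs (unzip1 w) (unzip2 w).
  by elim: w hw => [|[d u] w IH] //= [hu /IH].
have := em _ _ _ _ hx hd.
rewrite (transfer_inner _ alg_deg) // (transfer_outer hx hw _ dm) -sgD addrC.
by move=> /(congr1 (sg (twsign i w))); rewrite sgK sg0.
Qed.

(** The relation of the algebra is the module relation of [A] over itself: the terms with r = 0 form
    the outer sum, the others the inner sum. *)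
Lemma alg_eq : bcomp b b + ins b b = 0.
Proof.
apply: (twist_bmod alg_deg) => i d x a hx hd.
have := @alg_m_eq _ _ _ A (i :: d) (x :: a) (conj hx hd) isT.
rewrite /= big_nat_recl // addrC => <-; congr (_ + _).
  rewrite /inner_sum big_add1 /=; apply: eq_big_nat => r /andP[_ ra].
  rewrite subSS; apply: eq_big_nat => s /andP[_ sa].
  by rewrite big_cons.
rewrite /outer_sum; apply: eq_big_nat => [] [|s] // /andP[_ sa].
by rewrite /= subn0 big_nil mulr0 addr0 add0n.
Qed.

Lemma module_bmod (M : ainfModule A) : bmod b (twist (value (mod_m M))).
Proof.
have dm : fdeg 1 (value (mod_m M)).
  exact/(value_deg _ (erefl (1 + 1)))/mod_m_degree.
split; first exact/mlin_twist/mlin_value.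
  exact: fdeg_twist.
by apply: (twist_bmod dm) => i d x a hx hd; apply: mod_m_eq.
Qed.

Lemma ainf_idE (M : ainfModule A) i (w : seq (int * A)) (x : M) :
  ainf_id x (unzip2 w) = sg (twsign i w) (@idf _ _ _ A M x (unzip2 w)).
Proof. by case: w => [|l w] //=; rewrite sg0. Qed.

(** As [twist] is an involution, twisting a bar homotopy once more yields one with the signs of the
    definition. *)
Lemma bar_homotopic (M : ainfModule A) (N : ainfModule A) (f : ainfMorphism M N)
  (g : ainfMorphism N M) (h : M -> seq A -> M) :
  mlin h -> fdeg (-1) h ->
  bcomp (twist (value g)) (twist (value f)) - @idf _ _ _ A M
    = diff b (twist (value (mod_m M))) (twist (value (mod_m M))) true h ->
  homotopic (ainf_comp g f) (@ainf_id _ _ _ A M).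
Proof.
move=> mh dh Eh.
have [h1 h1E] := value_surj (mlin_twist mh).
have dh1 : fdeg (-1) (value h1) by rewrite h1E; apply: fdeg_twist.
have dm : fdeg 1 (value (mod_m M)).
  exact/(value_deg _ (erefl (1 + 1)))/mod_m_degree.
have df : fdeg 0 (value f) by exact/(value_deg _ (erefl (0 + 1)))/mor_f_degree.
exists h1.
  apply: (@eq_degree _ _ _ (fun n => 0 - n%:Z)) => [n|]; first by rewrite sub0r.
  exact/(value_deg _ (erefl (- 1 + 1))).
move=> i _ x _ hx /homogs_hlet [w [hw <- <-]].
rewrite (transfer_diff1 hx hw _ dm dh1) h1E twistK -Eh homDE homNE sgD sgN.
rewrite -(ainf_idE i); congr (_ - _).
by apply: (transfer_comp _ df _ hx hw) => r s; rewrite oddM andbC.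
Qed.
End Main.

Theorem theorem9p16 (k : fieldType) (S : pzRingType) (eta : {rmorphism k -> S})
    (hS : finite_product_of_copies eta) (A : ainfAlgebra eta)
    (M N : ainfModule A) (f : ainfMorphism M N) :
  quasi_isomorphism f -> homotopy_equivalence f.
Proof.
move=> qf.
have mf := mlin_twist (mlin_value f).
have df : fdeg 0 (value f) by exact/(value_deg _ (erefl (0 + 1)))/mor_f_degree.
have dM : fdeg 1 (value (mod_m M)).
  exact/(value_deg _ (erefl (1 + 1)))/mod_m_degree.
have dN : fdeg 1 (value (mod_m N)).
  exact/(value_deg _ (erefl (1 + 1)))/mod_m_degree.
have [bM bN] := (module_bmod M, module_bmod N).
have cf : diff (twist (value (@alg_m _ _ _ A))) (twist (value (mod_m M)))
    (twist (value (mod_m N))) false (twist (value f)) = 0.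
  apply: mlin_ext => [|i x w hx hw].
    exact: (mlin_diff (mlin_b A) (b_lact (A := A)) bM bN false mf).
  have hd : homogs (unzip1 w) (unzip2 w).
    by elim: w hw => [|[d u] w IH] //= [hu /IH].
  have := mor_f_eq f hx hd; rewrite (transfer_diff0 hx hw _ dM df).
  by move/eqP; rewrite oppr_eq0 => /eqP /(congr1 (sg (twsign i w)));
    rewrite sgK sg0.
have f_inj i (x : M) (z : N) : homog i x -> mod_d x = 0 ->
    homog (i - 1) z -> mor_1 f x = mod_d z ->
    exists2 y, homog (i - 1) y & x = mod_d y.
  move=> hx mx hz fx; have [inj _] := qf i.
  have [|||y hy] := inj x 0; last by rewrite subr0 => ->; exists y.
  - by [].
  - by split; [apply: homog0|apply: raddf0].
  - by exists z => //; rewrite /mor_1 raddf0 subr0.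
have f_surj i (z : N) : homog i z -> mod_d z = 0 ->
    exists x w, [/\ homog i x, mod_d x = 0, homog (i - 1) w &
      mor_1 f x - z = mod_d w].
  move=> hz nz; have [_ surj] := qf i.
  by have [//|x [hx mx] [w hw fx]] := surj z; exists x, w.
have [g [h [h' [[mg dg cg] [mh dh Eh] [mh' dh' Eh']]]]] :=
  homotopy_inverse (product_sum_minimal hS) (mlin_b A) (@deg_b _ _ _ A) (alg_eq
    A)
    (b_lact (A := A)) bM bN mf (fdeg_twist df) cf f_inj f_surj.
(* The inverse found is a bar family; [g1] is the actual family whose twist is [g]. *)
have [g1 g1E] := value_surj (mlin_twist mg).
have dg1 : fdeg 0 (value g1) by rewrite g1E; apply: fdeg_twist.
have g1K : twist (value g1) = g by rewrite g1E twistK.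
have g1_deg : tfamily_degree g1 (fun n => 1 - n%:Z).
  exact/(value_deg _ (erefl (0 + 1))).
have g1_eq : @ainf_morphism_eq _ _ _ A N M g1.
  move=> i _ x _ hx /homogs_hlet [w [hw <- <-]].
  by rewrite (transfer_diff0 hx hw _ dN dg1) g1K cg sg0 oppr0.
exists (AinfMorphism g1_deg g1_eq); split.
- by apply: bar_homotopic mh' dh' _; rewrite g1K.
- by apply: bar_homotopic mh dh _; rewrite g1K.
Qed.
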